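(* Let $r>0$, and assume that the exact source term satisfies $g\in D\left(\exp\left(\frac{(-L)^r}{2}\right)\right)$ with $\|g\|_{r,\mathrm{exp}}\le E$. Let $\tilde g_{\tau,r}^\delta$ be the exponential quasi-boundary value regularized solution, where the regularization parameter $\tau>0$ is chosen by the Morozov discrepancy principle $\|K\tilde g_{\tau,r}^\delta-\hat h^\delta\|=\rho\delta$. Then, for any $p>0$, $$\|\tilde g_{\tau,r}^{\delta}-g\|\le C\,\delta\left(1+|\ln\delta|\right)^{1/r}+C\,E^{\frac{2}{p+2}}(1+\rho)^{\frac{p}{p+2}}\delta^{\frac{p}{p+2}}.$$ In particular, since $\delta(1+|\ln\delta|)^{1/r}=o\left(\delta^{\frac{p}{p+2}}\right)$ as $\delta\to0^+$, we further have $$\|\tilde g_{\tau,r}^{\delta}-g\|\le C(1+E)(1+\rho)^{\frac{p}{p+2}}\delta^{\frac{p}{p+2}},\qquad p>0.$$ Here $C>0$ is a generic constant (possibly different in the two estimates) independent of $\delta$ and $\tau$.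
   Context: Fix $\alpha\in(0,1]$, $\beta\ge 0$, $l>0$, a constant $\rho>1$, and a bounded connected domain $\Omega\subset\mathbb{R}^N$ ($N\ge1$) with smooth boundary. $(\cdot,\cdot)$ and $\|\cdot\|$ are the inner product and norm of $L^2(\Omega)$. $-L:H^2(\Omega)\cap H_0^1(\Omega)\to L^2(\Omega)$ is a fixed symmetric uniformly elliptic operator with eigenpairs $-L\varphi_k=\lambda_k\varphi_k$, $0<\lambda_1\le\lambda_2\le\cdots\to\infty$, where $\{\varphi_k\}_{k\ge1}$ is a complete orthonormal basis of $L^2(\Omega)$. $\|\psi\|_{r,\mathrm{exp}}=(\sum_k\exp(\lambda_k^r)|(\psi,\varphi_k)|^2)^{1/2}$, and $D(\exp(\frac{(-L)^r}{2}))$ is the subspace of $L^2(\Omega)$ where this norm is finite. Kilbas–Saigo function: $E_{\alpha,m,n}(z)=1+\sum_{k=1}^\infty\prod_{j=0}^{k-1}\frac{\Gamma(\alpha(jm+n)+1)}{\Gamma(\alpha(jm+n+1)+1)}z^k$ ($\alpha,m>0$, $n>-1/\alpha$); the plain letter $E>0$ without subscripts denotes the bound on $\|g\|_{r,\mathrm{exp}}$. Put $\eta_2=\frac{\Gamma(1+\beta)}{\Gamma(1+\alpha+\beta)}$ and $$\sigma_k=\frac{\eta_2}{\sqrt{\lambda_k}}\,l^{\alpha+\beta}E_{\alpha,1+\frac{\beta}{\alpha},1+\frac{2\beta}{\alpha}}\left(-\sqrt{\lambda_k}\,l^{\alpha+\beta}\right),\qquad Kg=\sum_{k=1}^\infty\sigma_k(g,\varphi_k)\varphi_k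 .$$ $\hat h=Kg$ is the exact data, and the noisy data $\hat h^\delta\in L^2(\Omega)$, with noise level $\delta>0$, satisfy $\|\hat h^\delta-\hat h\|\le\delta$ and $0<\rho\delta<\|\hat h^\delta\|$. For $\tau>0$ the exponential quasi-boundary value regularized solution is $$\tilde g_{\tau,r}^\delta=\sum_{k=1}^\infty\frac{1}{\sigma_k+\tau\exp(\lambda_k^r)}(\hat h^\delta,\varphi_k)\varphi_k .$$ *)

(* Defs.v *)
From HB Require Import structures.
From mathcomp Require Import all_boot all_order all_algebra.
From mathcomp Require Import all_classical all_reals all_analysis.
From mathcomp Require Import measurable_realfun.
Set Implicit Arguments.
Unset Strict Implicit.
Unset Printing Implicit Defensive.
Import Order.TTheory GRing.Theory Num.Theory.
Import numFieldNormedType.Exports.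
Local Open Scope classical_set_scope.
Local Open Scope ring_scope.

Fact rV_borel_display : measure_display. Proof. exact: default_measure_display. Qed.

Section borel.
Context (R : realType) (n : nat).
Let B : set (set 'rV[R]_n) := <<s @open 'rV[R]_n >>.
Let B0 : B set0. Proof. exact: sigma_algebra0. Qed.
Let BC A : B A -> B (~` A). Proof. exact: sigma_algebraC. Qed.
Let BU (F : (set 'rV[R]_n)^nat) : (forall i, B (F i)) -> B (\bigcup_i F i).
Proof. exact: sigma_algebra_bigcup. Qed.
HB.instance Definition _ :=
  @isMeasurable.Build rV_borel_display 'rV[R]_n B B0 BC BU.
End borel.

Section prod_sigma_finite.
Context d1 d2 (T1 : measurableType d1) (T2 : measurableType d2) (R : realType).
Variables (m1 : {sigma_finite_measure set T1 -> \bar R})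
          (m2 : {sigma_finite_measure set T2 -> \bar R}).

Definition prod_measure : set (T1 * T2)%type -> \bar R := (m1 \x m2)%E.
HB.instance Definition _ := Measure.on prod_measure.

Let prod_measure_sigma_finite : sigma_finite setT prod_measure.
Proof.
have /sigma_finiteP[F [TF ndF Foo]] := sigma_finiteT m1.
have /sigma_finiteP[G [TG ndG Goo]] := sigma_finiteT m2.
exists (fun n => F n `*` G n).
  rewrite -setXTT TF TG predeqE => -[x y]; split.
    move=> [/= [n _ Fnx] [k _ Gky]]; exists (maxn n k) => //; split.
    - by move: x Fnx; exact/subsetPset/ndF/leq_maxl.
    - by move: y Gky; exact/subsetPset/ndG/leq_maxr.
  by move=> [n _ []/= ? ?]; split; exists n.
move=> k; have [? ?] := Foo k; have [? ?] := Goo k.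
split; first exact: measurableX.
by rewrite /prod_measure product_measure1E// lte_mul_pinfty// ge0_fin_numE.
Qed.
HB.instance Definition _ :=
  Measure_isSigmaFinite.Build _ _ _ prod_measure prod_measure_sigma_finite.
End prod_sigma_finite.

(* A sigma-finite measure space with real coordinate functions, used to form the
   n-fold product of the Lebesgue measure of R by recursion on n: in
   [coord_spaceX n] the first n coordinates are those of R * (R * ... * unit).
   The measure [lebesgue_rV] on row vectors is the image of that product; its
   value on boxes is [lebesgue_rV_box]. *)
Record coord_space (R : realType) := CoordSpace {
  cs_disp : measure_display;
  cs_type : measurableType cs_disp;
  cs_measure : {sigma_finite_measure set cs_type -> \bar R};
  cs_coord : nat -> cs_type -> R;
  cs_coordP : forall i, measurable_fun setT (cs_coord i) }.

Section lebesgue_rV.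
Context (R : realType).

Definition coord_space0 : coord_space R.
Proof.
refine (@CoordSpace R _ unit (@dirac _ unit tt R) (fun _ _ => 0) _).
by move=> i; exact: measurable_cst.
Defined.

Definition coord_spaceS (S : coord_space R) : coord_space R.
Proof.
refine (@CoordSpace R _ (measurableTypeR R * cs_type S)%type
  (prod_measure (@lebesgue_measure R) (cs_measure S))
  (fun i x => if i is j.+1 then cs_coord j x.2 else x.1) _).
move=> [|j]; first exact: measurable_fst.
exact: (measurableT_comp (cs_coordP j) measurable_snd).
Defined.

Fixpoint coord_spaceX n : coord_space R :=
  if n is m.+1 then coord_spaceS (coord_spaceX m) else coord_space0.

Definition row_of_coord n (x : cs_type (coord_spaceX n)) : 'rV[R]_n :=
  \row_(i < n) cs_coord i x.

Lemma measurable_row_of_coord n : measurable_fun setT (@row_of_coord n).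
Proof.
apply: (measurability (@open 'rV[R]_n)) => //.
move=> _ [U oU <-]; rewrite setTI.
pose c (q : 'rV[rat]_n) : 'rV[R]_n := map_mx ratr q.
pose D := [set t : 'rV[rat]_n * nat | ball (c t.1) t.2.+1%:R^-1 `<=` U].
have -> : U = \bigcup_(t in D) ball (c t.1) t.2.+1%:R^-1.
  apply/seteqP; split=> [x Ux|x [t Dt]]; last exact: Dt.
  have : nbhs x U by exact: open_nbhs_nbhs.
  move=> /nbhs_ballP[e /= e0 eU].
  have e20 : 0 < e / 2 by rewrite divr_gt0.
  have [k _ /(_ _ (leqnn k)) ke] := near_infty_natSinv_lt (PosNum e20).
  have hq i : exists q : rat, `|x ord0 i - ratr q| < k.+1%:R^-1.
    have [q] : exists q : rat, ratr q \in `](x ord0 i - k.+1%:R^-1), (x ord0 i + k.+1%:R^-1)[.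
      apply: rat_in_itvoo; rewrite ltrBlDr -addrA ltrDl.
      by rewrite addr_gt0 ?invr_gt0 ?ltr0n.
    rewrite in_itv/= => /andP[a b]; exists q.
    by rewrite distrC ltr_distl a b.
  have [q qP] := choice hq.
  exists (\row_i q i, k) => /=.
    rewrite /D /= => y [_ yq]; apply: eU; split=> // i j.
    have := yq i j; rewrite /c !mxE /= /ball /= => yj.
    rewrite !ord1 in yj *.
    rewrite (le_lt_trans (ler_distD (ratr (q j)) _ _))// [e]splitr.
    by apply: ltrD; [exact: lt_trans (qP j) ke|exact: lt_trans yj ke].
  split; first by rewrite invr_gt0 ltr0n.
  by move=> i j; rewrite /c !mxE /= /ball /= !ord1 distrC; exact: qP.
rewrite bigcup_mkcond preimage_bigcup.
apply: countable_bigcupT_measurable => [|[q k]].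
  exact: countableP.
case: ifPn => _; last by rewrite preimage_set0.
have -> : @row_of_coord n @^-1` ball (c q) k.+1%:R^-1 =
    \bigcap_(i in [set: 'I_n])
      (setT `&` cs_coord i @^-1` ball (c q ord0 i) k.+1%:R^-1).
  apply/seteqP; split=> [x xb i _|x xb].
    by split=> //; have [_ /(_ ord0 i)] := xb; rewrite !mxE.
  split=> [|i j]; first by rewrite invr_gt0 ltr0n.
  by have [_] := xb j I; rewrite !ord1 !mxE.
apply: fin_bigcap_measurable; first exact: finite_finset.
by move=> i _; apply: cs_coordP => //; exact: measurable_ball.
Qed.

Definition lebesgue_rV n : set 'rV[R]_n -> \bar R :=
  pushforward (cs_measure (coord_spaceX n)) (@row_of_coord n).

Let lebesgue_rV0 n : @lebesgue_rV n set0 = 0%E.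
Proof. by rewrite /lebesgue_rV /pushforward preimage_set0 measure0. Qed.

Let lebesgue_rV_ge0 n A : (0 <= @lebesgue_rV n A)%E.
Proof. by rewrite /lebesgue_rV /pushforward measure_ge0. Qed.

Let lebesgue_rV_sigma_additive n : semi_sigma_additive (@lebesgue_rV n).
Proof.
move=> F mF tF mUF; rewrite /lebesgue_rV /pushforward preimage_bigcup.
have mp A : measurable A -> measurable (@row_of_coord n @^-1` A).
  by move=> mA; rewrite -[X in measurable X]setTI; exact: measurable_row_of_coord.
apply: measure_semi_sigma_additive.
- by move=> k; exact: mp.
- apply/trivIsetP => /= i j _ _ ij; rewrite -preimage_setI.
  by move/trivIsetP : tF => /(_ _ _ _ _ ij) ->//; rewrite preimage_set0.
- by rewrite -preimage_bigcup; exact: mp.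
Qed.

HB.instance Definition _ n := isMeasure.Build _ _ _ (@lebesgue_rV n)
  (@lebesgue_rV0 n) (@lebesgue_rV_ge0 n) (@lebesgue_rV_sigma_additive n).
End lebesgue_rV.
Arguments lebesgue_rV {R n}.

Lemma lebesgue_rV_box (R : realType) n (A : nat -> set (measurableTypeR R)) :
  (forall i, measurable (A i)) ->
  (@lebesgue_rV R n [set x | forall i : 'I_n, A i (x ord0 i)] =
   \prod_(i < n) lebesgue_measure (A i))%E.
Proof.
move=> mA; rewrite /lebesgue_rV /pushforward.
have -> : @row_of_coord R n @^-1` [set x | forall i : 'I_n, A i (x ord0 i)] =
    [set x | forall i, (i < n)%N -> A i (cs_coord i x)].
  apply/seteqP; split=> x /= xA i; last by rewrite mxE; exact: xA.
  by move=> ni; have := xA (Ordinal ni); rewrite mxE.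
have mB m (B : nat -> set (measurableTypeR R)) : (forall i, measurable (B i)) ->
    measurable [set x : cs_type (coord_spaceX R m) |
                forall i, (i < m)%N -> B i (cs_coord i x)].
  move=> mB'; rewrite (_ : [set _ | _] =
      \bigcap_(i in `I_m) (setT `&` cs_coord i @^-1` B i)).
    apply: fin_bigcap_measurable => [|i _]; first exact: finite_II.
    by apply: cs_coordP => //; exact: mB'.
  by apply/seteqP; split=> x xB i im; [split=> //; exact: xB|have [] := xB i im].
elim: n A mA => [|n IH] A mA.
  rewrite big_ord0 /= (_ : [set _ | _] = setT) ?diracT//.
  by apply/seteqP; split.
rewrite big_ord_recl -(IH (fun i => A i.+1)); last by move=> i; exact: mA.
rewrite [LHS]/= /prod_measure -product_measure1E//; 
  last by apply: (mB n (fun i => A i.+1)) => i; exact: mA.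
congr (product_measure1 _ _ _).
apply/seteqP; split=> [[y z] /= yz|[y z] /= [Ay Az] [|i] ni//]; last exact: Az.
by split=> [|i ni]; [exact: (yz 0%N)|exact: (yz i.+1)].
Qed.

Section function_spaces.
Context (R : realType) (N : nat).
Notation X := 'rV[R]_N.
Implicit Types (Omega : set X) (u v f g : X -> R).

Definition L2 Omega f :=
  measurable_fun Omega f /\
  (\int[@lebesgue_rV R N]_(x in Omega) (f x ^+ 2)%:E < +oo)%E.

Definition L2_inner Omega f g : R :=
  \int[@lebesgue_rV R N]_(x in Omega) (f x * g x).

Definition L2_norm Omega f : R := Num.sqrt (L2_inner Omega f f).

(* Elements of L2 are represented by functions, equality being equality almost
   everywhere in Omega; [L2_sum Omega c phi f] says that [f] represents the sum
   of the series of the [c k *: phi k], convergent in L2. *)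
Definition L2_sum Omega (c : nat -> R) (phi : nat -> X -> R) f :=
  L2 Omega f /\
  L2_norm Omega (fun x => (\sum_(0 <= k < n) c k * phi k x) - f x)
    @[n --> \oo] --> (0 : R).

Definition orthonormal_basis Omega (phi : nat -> X -> R) :=
  [/\ forall k, L2 Omega (phi k),
      forall j k, L2_inner Omega (phi j) (phi k) = (j == k)%:R &
      forall f, L2 Omega f ->
        L2_sum Omega (fun k => L2_inner Omega f (phi k)) phi f].

Definition pderiv (i : 'I_N) f : X -> R := fun x => 'D_(delta_mx 0 i) f x.

Definition smooth f :=
  forall s : seq 'I_N, let h := foldr pderiv f s in
    continuous h /\ forall x i, derivable h x (delta_mx 0 i).

(* The boundary of Omega is locally the regular zero set of a smooth function
   which is negative exactly in Omega. *)
Definition smooth_boundary Omega :=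
  forall x0, closure Omega x0 -> ~ Omega x0 ->
    exists psi : X -> R, [/\ smooth psi, exists i, pderiv i psi x0 != 0 &
      \forall x \near x0, Omega x <-> psi x < 0].

Definition smooth_bounded_domain Omega :=
  [/\ open Omega, connected Omega, Omega !=set0, bounded_set Omega &
      smooth_boundary Omega].

Definition test_function Omega f :=
  smooth f /\ exists K, [/\ compact K, K `<=` Omega &
    forall x, ~ K x -> f x = 0].

Definition weak_pderiv Omega (i : 'I_N) u v :=
  [/\ L2 Omega u, L2 Omega v &
      forall f, test_function Omega f ->
        L2_inner Omega u (pderiv i f) = - L2_inner Omega v f].

(* [p i] and [q i j] are the weak derivatives of [u] of orders one and two. *)
Definition H2_jet Omega u (p : 'I_N -> X -> R) (q : 'I_N -> 'I_N -> X -> R) :=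
  (forall i, weak_pderiv Omega i u (p i)) /\
  (forall i j, weak_pderiv Omega j (p i) (q i j)).

Definition H2 Omega u := L2 Omega u /\ exists p q, H2_jet Omega u p q.

Definition H10 Omega u :=
  L2 Omega u /\ exists p : 'I_N -> X -> R,
    (forall i, weak_pderiv Omega i u (p i)) /\
    exists f : nat -> X -> R,
      [/\ forall n, test_function Omega (f n),
          L2_norm Omega (fun x => f n x - u x) @[n --> \oo] --> (0 : R) &
          forall i, L2_norm Omega (fun x => pderiv i (f n) x - p i x)
            @[n --> \oo] --> (0 : R)].

(* Values [mL u] matter only for u in the domain H2 /\ H10, on which
     mL u = - sum_ij a_ij D_ij u - sum_i b_i D_i u + c u
   with bounded measurable coefficients and (a_ij) uniformly positive definite;
   operators in divergence form with C^1 leading coefficients are of this form.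
   Symmetry is that of the operator in L2. *)
Definition symmetric_uniformly_elliptic Omega (mL : (X -> R) -> X -> R) :=
  (exists (a : 'I_N -> 'I_N -> X -> R) (b : 'I_N -> X -> R) (c : X -> R),
    [/\ (forall i j, measurable_fun Omega (a i j)) /\
          (forall i, measurable_fun Omega (b i)) /\ measurable_fun Omega c,
        exists M : R, forall x, Omega x ->
          [/\ forall i j, `|a i j x| <= M, forall i, `|b i x| <= M &
              `|c x| <= M],
        forall i j x, Omega x -> a i j x = a j i x,
        exists2 nu : R, 0 < nu & forall x (xi : X), Omega x ->
          nu * (\sum_i xi ord0 i ^+ 2) <=
            \sum_i \sum_j a i j x * xi ord0 i * xi ord0 j &
        forall u p q, H2 Omega u -> H10 Omega u -> H2_jet Omega u p q ->
          L2 Omega (mL u) /\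
          {ae @lebesgue_rV R N, forall x, Omega x ->
            mL u x = - (\sum_i \sum_j a i j x * q i j x)
                     - (\sum_i b i x * p i x) + c x * u x}]) /\
  (forall u v, H2 Omega u -> H10 Omega u -> H2 Omega v -> H10 Omega v ->
    L2_inner Omega (mL u) v = L2_inner Omega u (mL v)).

(* Indices start at 0: [lam k] and [phi k] are the (k+1)-st eigenpair. *)
Definition eigensystem Omega (mL : (X -> R) -> X -> R) (lam : nat -> R)
    (phi : nat -> X -> R) :=
  [/\ orthonormal_basis Omega phi,
      forall k, [/\ H2 Omega (phi k), H10 Omega (phi k) &
        {ae @lebesgue_rV R N, forall x, Omega x ->
          mL (phi k) x = lam k * phi k x}],
      0 < lam 0%N, {homo lam : j k / (j <= k)%N >-> j <= k} &
      lam k @[k --> \oo] --> +oo].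

(* The square of [exp_norm], possibly infinite. *)
Definition exp_sqnorm Omega (lam : nat -> R) (phi : nat -> X -> R) (r : R) f
    : \bar R :=
  (\sum_(0 <= k <oo)
    (expR (lam k `^ r) * `|L2_inner Omega f (phi k)| ^+ 2)%:E)%E.

Definition exp_dom Omega lam phi r f :=
  L2 Omega f /\ (exp_sqnorm Omega lam phi r f < +oo)%E.

Definition exp_norm Omega lam phi r f : R :=
  Num.sqrt (fine (exp_sqnorm Omega lam phi r f)).

End function_spaces.

Section regularization.
Context (R : realType).

Definition Gamma (x : R) : R :=
  \int[lebesgue_measure]_(t in `]0, +oo[) (t `^ (x - 1) * expR (- t)).

Definition Kilbas_Saigo (alpha m n z : R) : R :=
  1 + limn (fun K => \sum_(1 <= k < K)
    (\prod_(0 <= j < k) (Gamma (alpha * (j%:R * m + n) + 1) /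
                         Gamma (alpha * (j%:R * m + n + 1) + 1))) * z ^+ k).

Definition eta2 (alpha beta : R) : R :=
  Gamma (1 + beta) / Gamma (1 + alpha + beta).

Definition sigma (alpha beta l lambda : R) : R :=
  eta2 alpha beta / Num.sqrt lambda * l `^ (alpha + beta) *
  Kilbas_Saigo alpha (1 + beta / alpha) (1 + 2 * beta / alpha)
    (- (Num.sqrt lambda * l `^ (alpha + beta))).

Context (N : nat).
Notation X := 'rV[R]_N.

(* [is_K ... g h] says that h represents K g. *)
Definition is_K (alpha beta l : R) Omega (lam : nat -> R)
    (phi : nat -> X -> R) (g h : X -> R) :=
  L2_sum Omega
    (fun k => sigma alpha beta l (lam k) * L2_inner Omega g (phi k)) phi h.

(* [is_regularized ... tau hd gt] says that gt represents the exponential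
   quasi-boundary value regularized solution for the data hd. *)
Definition is_regularized (alpha beta l : R) Omega (lam : nat -> R)
    (phi : nat -> X -> R) (r tau : R) (hd gt : X -> R) :=
  L2_sum Omega
    (fun k => (sigma alpha beta l (lam k) + tau * expR (lam k `^ r))^-1 *
              L2_inner Omega hd (phi k)) phi gt.

End regularization.

(* Main.v *)
Require Import Defs.
From mathcomp Require Import all_boot all_order all_algebra.
From mathcomp Require Import all_classical all_reals all_analysis.
From mathcomp Require Import ring lra measurable_realfun.
Set Implicit Arguments.
Unset Strict Implicit.
Unset Printing Implicit Defensive.
Import Order.TTheory GRing.Theory Num.Theory.
Import numFieldNormedType.Exports.
Local Open Scope classical_set_scope.
Local Open Scope ring_scope.

(* Write [lambda = lam k], [z = sqrt lambda * l ^ (alpha + beta)]. The symbol of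
   [K] is [sigma = (1 - F (- z)) / lambda], where
   [F x = sum_k c_k x^k] is the Kilbas-Saigo function
   [E_(alpha, m, m - 1)], [m = 1 + beta / alpha]. On [z >= 0], [F (- z)] is
   nonnegative and nonincreasing: [k! c_k] is a product of Gamma quotients, and
   [c_k] is the limit of the coefficients of [exp] multiplied by finitely many
   sequences [phi i / phi (i + k)]; by Gauss's product each of these is in turn a
   limit of products of sequences [1 + s / (y + gam * k)] with [s >= 0], and such a
   multiplier preserves nonnegativity on the negative axis (it solves a first
   order differential equation). Hence
   [const / lambda <= sigma <= 1 / lambda].

   With [e = exp (lambda ^ r)] and [w = 2 / (p + 2)], the discrepancy principle
   gives [tau >= const * delta^2 / E^2]. The error is the sum of the propagated
   noise, at most [delta * sup (sigma + tau e)^-1 <= const * delta * tau^(- w / 2)],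
   and of the bias [tau e / (sigma + tau e) * g], whose image under [K] has norm
   at most [(1 + rho) delta] and whose exponential norm is at most [E], so that
   interpolation applies. Both are
   [O ((1 + rho)^(p / (p + 2)) E^w delta^(p / (p + 2)))], which implies the two
   estimates of the theorem. *)

(** * The Gamma function *)

(** The bound for exponent one, [1 + u <= M * expR (b * u)], is raised to the power [q]. The rate
    [b = a / (1 + q)] satisfies [b * q <= a] and stays defined at [q = 0]. *)
Lemma powR_1D_le_expR (R : realType) (q a : R) : 0 <= q -> 0 < a ->
  exists2 C : R, 0 < C & forall u : R, 0 <= u -> (1 + u) `^ q <= C * expR (a * u).
Proof.
move=> q0 a0.
have q1 : 0 < 1 + q by lra.
pose b := a / (1 + q).
have b0 : 0 < b by rewrite divr_gt0.
pose M := 1 + b^-1.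
have M0 : 0 < M by rewrite addr_gt0 ?invr_gt0.
exists (M `^ q); first exact: powR_gt0.
move=> u u0.
have M1u : 1 + u <= M * expR (b * u).
  have h := expR_ge1Dx (b * u).
  apply: le_trans (ler_wpM2l (ltW M0) h).
  have bV : 0 < b^-1 by rewrite invr_gt0.
  rewrite /M mulrDl mul1r mulrDr mulr1 mulrA mulVf ?gt_eqF// mul1r.
  have bu0 : 0 <= b * u by apply: mulr_ge0 => //; exact: ltW.
  by lra.
apply: (@le_trans _ _ ((M * expR (b * u)) `^ q)).
  by apply: ge0_ler_powR => //; rewrite nnegrE ?mulr_ge0 ?expR_ge0//; lra.
rewrite powRM ?expR_ge0//; last lra.
rewrite ler_wpM2l ?powR_ge0// -expRM ler_expR /b.
rewrite -[leRHS]mulr1 [leLHS](_ : _ = a * u * (q / (1 + q))); last by field; lra.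
rewrite ler_wpM2l ?mulr_ge0//; first lra.
by rewrite ler_pdivrMr// mul1r; lra.
Qed.

Lemma integrable_EFinZl (d : measure_display) (T : measurableType d) (R : realType)
    (mu : {measure set T -> \bar R}) (D : set T) (k : R) (f : T -> R) :
  measurable D -> mu.-integrable D (EFin \o f) ->
  mu.-integrable D (EFin \o (fun x => k * f x)).
Proof.
move=> mD /(integrableZl mD k); exact: eq_integrable.
Qed.

Section Gamma_function.
Context {R : realType}.
Notation mu := (@lebesgue_measure R).
Implicit Types x t s d c : R.

Let g x t : R := t `^ (x - 1) * expR (- t).

Local Notation itv0y := (`[0%R, +oo[%classic : set R).

Lemma continuous_powR_gt0 (q t : R) : 0 < t -> {for t, continuous (fun u => u `^ q)}.
Proof.
move=> t0; apply: differentiable_continuous; apply/derivable1_diffP.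
by apply: derivable_powR; rewrite in_itv/= t0.
Qed.

Lemma powR_at_right0 (q : R) : 0 <= q -> t `^ q @[t --> 0^'+] --> (0 : R) `^ q.
Proof.
rewrite le_eqVlt => /predU1P[<-|q0].
  by rewrite powRr0; under eq_cvg do rewrite powRr0; exact: cvg_cst.
by rewrite powR0 ?gt_eqF//; exact: powR_cvg0.
Qed.

Let continuous_expRc (k : R) : continuous (fun t : R => expR (k * t)).
Proof.
move=> t; apply: continuous_comp; last exact: continuous_expR.
exact: mulrl_continuous.
Qed.

Let continuous_expRN : continuous (fun t : R => expR (- t)).
Proof.
move=> t; apply: continuous_comp; last exact: continuous_expR.
exact: opp_continuous.
Qed.

Lemma within_continuous_Gamma_integrand x : 1 <= x ->
  {within itv0y, continuous (g x)}.
Proof.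
move=> x1; apply/continuous_within_itvcyP; split.
  move=> t; rewrite in_itv/= andbT => t0; apply: cvgM.
    exact: continuous_powR_gt0.
  exact: continuous_expRN.
apply: cvgM; first by apply: powR_at_right0; lra.
by apply: cvg_at_right_filter; exact: continuous_expRN.
Qed.

(** Half of the exponential decay absorbs the power; the other half is left as an integrable
    majorant. *)
Lemma Gamma_integrand_le x : 1 <= x ->
  exists2 C : R, 0 < C & forall t, 0 <= t -> g x t <= C * expR (- 2^-1 * t).
Proof.
move=> x1; have x10 : 0 <= x - 1 by lra.
have h2 : (0 : R) < 2^-1 by lra.
have [C C0 hC] := powR_1D_le_expR x10 h2.
exists C => // t t0; rewrite /g.
have -> : - 2^-1 * t = 2^-1 * t + - t by lra.
rewrite expRD mulrA ler_wpM2r ?expR_ge0//.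
apply: le_trans (hC _ t0); apply: ge0_ler_powR; rewrite ?nnegrE//; lra.
Qed.

Lemma integrable_expR_half :
  mu.-integrable itv0y (EFin \o (fun t : R => expR (- 2^-1 * t))).
Proof.
have h2 : (0 : R) < 2^-1 by lra.
have h : mu.-integrable itv0y (EFin \o exponential_pdf 2^-1).
  exact: integrableS (@subsetT _ _) (integrable_exponential_pdf h2).
have := @integrableZl _ _ _ mu _ (measurable_itv _) 2 _ h.
apply: eq_integrable => // t; rewrite inE/= in_itv/= andbT => t0 /=.
by rewrite exponential_pdfE// -EFinM mulrA divff ?mul1r.
Qed.

Lemma integrable_Gamma x : 1 <= x -> mu.-integrable itv0y (EFin \o g x).
Proof.
move=> x1; have [C C0 hC] := Gamma_integrand_le x1.
have := @integrableZl _ _ _ mu itv0y (measurable_itv _) C _ integrable_expR_half.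
apply: le_integrable => //.
  apply/measurable_EFinP; apply: measurable_funTS; apply: measurable_funM.
    exact: measurable_powR.
  exact: continuous_measurable_fun.
move=> t; rewrite /= in_itv/= andbT => t0; rewrite lee_fin.
rewrite ger0_norm ?mulr_ge0 ?powR_ge0 ?expR_ge0//.
by rewrite ger0_norm ?hC// mulr_ge0 ?expR_ge0// ltW.
Qed.

Lemma GammaE x : 1 <= x -> Gamma x = \int[mu]_(t in itv0y) g x t.
Proof.
move=> x1; rewrite /Gamma Rintegral_itv_obnd_cbnd//.
apply: integrableS (integrable_Gamma x1) => //.
by move=> t /=; rewrite !in_itv/= !andbT; exact: ltW.
Qed.

(** On the interval from 1 to 2 the integrand is at least [expR (- 2)], and it is nonnegative on the
    rest of the half-line. *)
Lemma Gamma_gt0 x : 1 <= x -> 0 < Gamma x.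
Proof.
move=> x1; rewrite GammaE//.
have mD : mu `[1, 2]%classic = 1%:E.
  rewrite lebesgue_measure_itv/= lte_fin ifT; last lra.
  by congr EFin; lra.
have [D [DE {}mD]] : exists D : set R, (D = `[1, 2]%classic) /\ (mu D = 1%:E).
  by exists `[1, 2]%classic.
have md : measurable (D : set (measurableTypeR R)).
  by rewrite DE; exact: measurable_itv.
have h1 : 0 < \int[mu]_(t in D) expR (- 2).
  by rewrite Rintegral_cst// [X in fine X]mD /= mulr1 expR_gt0.
apply: lt_le_trans h1 _.
have DS : D `<=` itv0y.
  by move=> t; rewrite DE/= !in_itv/= andbT => /andP[t1 _]; lra.
have iD : mu.-integrable D (EFin \o g x).
  by apply: integrableS (integrable_Gamma x1).
apply: (@le_trans _ _ (\int[mu]_(t in D) g x t)).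
  apply: le_Rintegral => //.
    apply: measurable_bounded_integrable => //; first by rewrite [ltLHS]mD ltry.
    exact: bounded_cst.
  move=> t; rewrite DE/= in_itv/= => /andP[t1 t2].
  rewrite /g -[leLHS]mul1r ler_pM ?expR_ge0//; last by rewrite ler_expR; lra.
  by rewrite -[leLHS](powRr0 t); apply: ler_powR => //; lra.
rewrite /Rintegral fine_le//.
- by apply: integrable_fin_num.
- by apply: integrable_fin_num => //; exact: integrable_Gamma.
apply: ge0_subset_integral => //.
  by case/integrableP: (integrable_Gamma x1).
by move=> t _; rewrite lee_fin mulr_ge0 ?powR_ge0 ?expR_ge0.
Qed.

Lemma cvgry_expR_half : expR (- 2^-1 * t) @[t --> (+oo : set_system R)] --> (0 : R).
Proof.
under eq_cvg do rewrite mulNr.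
apply: (@cvg_comp _ _ _ (fun t : R => 2^-1 * t) (fun z => expR (- z)) _
  (pinfty_nbhs R)); last exact: cvgr_expR.
by apply: gt0_cvgMry; rewrite ?invr_gt0//; exact: cvg_id.
Qed.

Lemma is_derive_Gamma_integrand x t : 0 < t ->
  is_derive t 1 (g x) ((x - 1) * g (x - 1) t - g x t).
Proof.
move=> t0; have tI : t \in `]0, +oo[ by rewrite in_itv/= t0.
have dp : is_derive t 1 (fun u : R => u `^ (x - 1)) ((x - 1) * t `^ (x - 1 - 1)).
  apply: DeriveDef; first exact: (@derivable_powR R).
  by rewrite -derive1E (@powR_derive1 R).
have de : is_derive t 1 (fun u : R => expR (- u)) (- expR (- t)).
  by apply: is_derive_eq; rewrite /GRing.scale/= mulrN1.
apply: (is_derive_eq (is_deriveM dp de)); rewrite /g /GRing.scale/=; ring.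
Qed.

(** Integration by parts, in the form of the fundamental theorem of calculus on the half-line for
    [F]. The version applied asks for a nonnegative integrand, whereas [g (x + 1) t - x * g x t]
    changes sign. The term [M * h t] compensates, and its integral [M * 2] is subtracted at the
    end. *)
Lemma GammaS x : 1 <= x -> Gamma (x + 1) = x * Gamma x.
Proof.
move=> x1; have x0 : 0 < x by lra.
have x11 : 1 <= x + 1 by lra.
have [C C0 hC] := Gamma_integrand_le x1.
have [C' C'0 hC'] := Gamma_integrand_le x11.
pose h t : R := expR (- 2^-1 * t).
pose M := x * C.
pose f t := g (x + 1) t - x * g x t + M * h t.
pose F t := - g (x + 1) t - 2 * M * h t.
have ig := integrable_Gamma x1.
have ig1 := integrable_Gamma x11.
have ih := integrable_expR_half.
have ixg : mu.-integrable itv0y (EFin \o (fun t => x * g x t)).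
  exact: integrable_EFinZl.
have iMh k : mu.-integrable itv0y (EFin \o (fun t => k * h t)).
  exact: integrable_EFinZl.
have hy : h t @[t --> +oo] --> 0.
  exact: cvgry_expR_half.
have h0 : h 0 = 1 by rewrite /h mulr0 expR0.
have hc (t : R) : {for t, continuous h} by exact: continuous_expRc.
have gy : g (x + 1) t @[t --> +oo] --> 0.
  apply: (@squeeze_cvgr _ _ _ _ (fun=> 0) (fun t => C' * h t)).
  - near=> t; rewrite mulr_ge0 ?powR_ge0 ?expR_ge0//=.
    by apply: hC'; near: t; exact: nbhs_pinfty_ge.
  - exact: cvg_cst.
  - by rewrite -(mulr0 C'); apply: cvgM; [exact: cvg_cst|exact: hy].
have g0 : g (x + 1) 0 = 0.
  by rewrite /g powR0 ?mul0r// gt_eqF//; lra.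
have ge2 : \int[mu]_(t in itv0y) h t = 2.
  have -> : \int[mu]_(t in itv0y) h t = 0 - (- 2 * h 0).
    apply: (Rintegral_ge0_continuous_FTC2y (F := fun t => - 2 * h t)).
    - by move=> t _; exact: expR_ge0.
    - apply: continuous_subspaceT; exact: hc.
    - by rewrite -(mulr0 (- 2)); apply: cvgM; [exact: cvg_cst|exact: hy].
    - by move=> t _; exact: ex_derive.
    - by apply: cvgM; [exact: cvg_cst|apply: cvg_at_right_filter; exact: hc].
    - move=> t _; rewrite /h derive1E.
      by rewrite derive_val /GRing.scale/=; lra.
  by rewrite h0; lra.
have dF t : 0 < t -> is_derive t 1 F (f t).
  move=> t0; have dh : is_derive t 1 h (- 2^-1 * h t).
    by apply: is_derive_eq; rewrite /h /GRing.scale/= mulr1 mulrC.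
  have dM := is_deriveM (is_derive_cst (2 * M) t (1 : R)) dh.
  have dB := is_deriveB (is_deriveN (is_derive_Gamma_integrand (x + 1) t0)) dM.
  apply: (is_derive_eq dB); rewrite /f /GRing.scale/=.
  by rewrite (_ : x + 1 - 1 = x); [field|lra].
have e : \int[mu]_(t in itv0y) f t = 0 - F 0.
  apply: (Rintegral_ge0_continuous_FTC2y (F := F)).
  - move=> t t0; rewrite /f.
    have : 0 <= g (x + 1) t by rewrite mulr_ge0 ?powR_ge0 ?expR_ge0.
    suff : x * g x t <= M * h t by lra.
    by rewrite /M -mulrA ler_wpM2l ?(ltW x0)// hC.
  - move=> t; apply: cvgD; last by apply: cvgM; [exact: cvg_cst|exact: continuous_subspaceT].
    apply: cvgB; first by apply: within_continuous_Gamma_integrand.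
    by apply: cvgM; [exact: cvg_cst|exact: within_continuous_Gamma_integrand].
  - rewrite -(subr0 0) -[X in - X](mulr0 (2 * M)) -{1}oppr0; apply: cvgB; first exact: cvgN.
    by apply: cvgM; [exact: cvg_cst|exact: hy].
  - by move=> t t0; have [] := dF t t0.
  - apply: cvgB.
      apply: cvgN; apply: cvgM; first by apply: powR_at_right0; lra.
      by apply: cvg_at_right_filter; exact: continuous_expRN.
    by apply: cvgM; [exact: cvg_cst|apply: cvg_at_right_filter; exact: hc].
  - move=> t; rewrite in_itv/= andbT => t0.
    by rewrite derive1E; have [_ ->] := dF t t0.
have : \int[mu]_(t in itv0y) f t = Gamma (x + 1) - x * Gamma x + M * 2.
  have igB : mu.-integrable itv0y (EFin \o (fun t => g (x + 1) t - x * g x t)).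
    by apply: eq_integrable (integrableB _ ig1 ixg).
  by rewrite RintegralD// RintegralB// !RintegralZl// ge2 !GammaE.
by rewrite e /F g0 h0 => h1; apply/eqP; rewrite -subr_eq0; apply/eqP; lra.
Unshelve. all: by end_near. Qed.

(** The difference of the integrands is the weight t^(x - 1) e^(- t) times (t^s - c^s) (t^d - c^d).
    These two factors have the same sign, since both powers are nondecreasing in [t]. *)
Lemma Gamma_chebyshev x s d c : 1 <= x -> 0 <= s -> 0 <= d -> 0 < c ->
  c `^ d * Gamma (x + s) + c `^ s * Gamma (x + d) <=
  Gamma (x + s + d) + c `^ (s + d) * Gamma x.
Proof.
move=> x1 s0 d0 c0.
have xs : 1 <= x + s by lra.
have xd : 1 <= x + d by lra.
have xsd : 1 <= x + s + d by lra.
have iG y : 1 <= y -> mu.-integrable `]0%R, +oo[ (EFin \o g y).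
  move=> y1; apply: integrableS (integrable_Gamma y1) => //.
  by move=> t /=; rewrite !in_itv/= !andbT; exact: ltW.
have iZ k y : 1 <= y -> mu.-integrable `]0%R, +oo[ (EFin \o (fun t => k * g y t)).
  by move=> y1; apply: integrable_EFinZl => //; exact: iG.
have lhsE : c `^ d * Gamma (x + s) + c `^ s * Gamma (x + d) =
    \int[mu]_(t in `]0%R, +oo[) (c `^ d * g (x + s) t + c `^ s * g (x + d) t).
  by rewrite RintegralD//; [rewrite !RintegralZl//; exact: iG|exact: iZ|exact: iZ].
have rhsE : Gamma (x + s + d) + c `^ (s + d) * Gamma x =
    \int[mu]_(t in `]0%R, +oo[) (g (x + s + d) t + c `^ (s + d) * g x t).
  by rewrite RintegralD//; [rewrite !RintegralZl//; exact: iG|exact: iG|exact: iZ].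
rewrite lhsE rhsE; apply: le_Rintegral => //.
- by apply: eq_integrable (integrableD _ (iZ (c `^ d) _ xs) (iZ (c `^ s) _ xd)).
- by apply: eq_integrable (integrableD _ (iG _ xsd) (iZ (c `^ (s + d)) _ x1)).
move=> t; rewrite /= in_itv/= andbT => t0; rewrite /g.
have t_neq0 : t != 0 by rewrite gt_eqF.
have powD y z : t `^ (y + z - 1) = t `^ (y - 1) * t `^ z.
  by rewrite addrAC powRD// t_neq0 implybT.
rewrite !powD (@powRD _ c) ?(gt_eqF c0) ?implybT//.
have m0 : 0 <= t `^ (x - 1) * expR (- t) by rewrite mulr_ge0 ?powR_ge0 ?expR_ge0.
rewrite -subr_ge0.
have -> : t `^ (x - 1) * t `^ s * t `^ d * expR (- t) +
   c `^ s * c `^ d * (t `^ (x - 1) * expR (- t)) -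
   (c `^ d * (t `^ (x - 1) * t `^ s * expR (- t)) +
    c `^ s * (t `^ (x - 1) * t `^ d * expR (- t))) =
   t `^ (x - 1) * expR (- t) * ((t `^ s - c `^ s) * (t `^ d - c `^ d)) by ring.
apply: mulr_ge0 => //; case: (leP t c) => [tc|/ltW ct].
  rewrite mulr_le0// subr_le0; apply: ge0_ler_powR => //; rewrite nnegrE; exact: ltW.
rewrite mulr_ge0// subr_ge0; apply: ge0_ler_powR => //; rewrite nnegrE; exact: ltW.
Qed.
End Gamma_function.

(** * Entire power series nonnegative on the negative axis *)

Section entire_power_series.
Context {R : realType}.
Implicit Types (a b A : nat -> R) (x y z : R).

Definition entire a := forall x, cvgn (pseries a x).

Definition psum a x : R := limn (pseries a x).

Definition nneg_at_neg a := forall z, 0 <= z -> 0 <= psum a (- z).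

Lemma pseries_cvg a x : entire a -> pseries a x @ \oo --> psum a x.
Proof. by move=> ea; exact: ea. Qed.

Lemma psum_unique a x (l : R) : pseries a x @ \oo --> l -> psum a x = l.
Proof. by move=> h; apply/cvg_lim. Qed.

Lemma entire_norm a x : entire a -> cvgn (series (fun k => `|a k * x ^+ k|)).
Proof.
move=> ea.
have h : `| `|x| | < `| `|x| + 1 |.
  by rewrite normr_id [ltRHS]ger0_norm ?ltrDl// addr_ge0.
have := is_cvg_pseries_inside_norm (ea (`|x| + 1)) h.
rewrite (_ : pseries _ _ = series (fun k => `|a k * x ^+ k|))//.
by rewrite /pseries; apply/funext => n; apply: eq_bigr => k _; rewrite normrM normrX.
Qed.

Lemma entire_norm_cvg a : (forall x, cvgn (series (fun k => `|a k * x ^+ k|))) -> entire a.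
Proof. by move=> h x; apply: normed_cvg; exact: h. Qed.

Lemma entire_le a A : entire A -> (forall k, `|a k| <= `|A k|) -> entire a.
Proof.
move=> eA aA; apply: entire_norm_cvg => x.
apply: (@series_le_cvg R _ (fun k => `|A k * x ^+ k|)) => // [k|].
  by rewrite !normrM ler_wpM2r.
exact: entire_norm.
Qed.

Lemma cvg_pseriesD a b x : entire a -> entire b ->
  pseries (fun k => a k + b k) x @ \oo --> psum a x + psum b x.
Proof.
move=> ea eb.
rewrite (_ : pseries _ _ = (fun n => pseries a x n + pseries b x n)).
  by apply: cvgD; exact: pseries_cvg.
apply/funext => n; rewrite /pseries /series/= -big_split.
by apply: eq_bigr => k _; rewrite mulrDl.
Qed.

Lemma entireD a b : entire a -> entire b -> entire (fun k => a k + b k).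
Proof. by move=> ea eb x; apply/cvg_ex; eexists; exact: cvg_pseriesD. Qed.

Lemma psumD a b x : entire a -> entire b ->
  psum (fun k => a k + b k) x = psum a x + psum b x.
Proof. by move=> ea eb; apply: psum_unique; exact: cvg_pseriesD. Qed.

Lemma cvg_pseriesZ (c : R) a x : entire a ->
  pseries (fun k => c * a k) x @ \oo --> c * psum a x.
Proof.
move=> ea; rewrite (_ : pseries _ _ = (fun n => c * pseries a x n)).
  by apply: cvgM; [exact: cvg_cst|exact: pseries_cvg].
apply/funext => n; rewrite /pseries /series/= mulr_sumr.
by apply: eq_bigr => k _; rewrite mulrA.
Qed.

Lemma entireZ (c : R) a : entire a -> entire (fun k => c * a k).
Proof. by move=> ea x; apply/cvg_ex; eexists; exact: cvg_pseriesZ. Qed.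

Lemma psumZ (c : R) a x : entire a -> psum (fun k => c * a k) x = c * psum a x.
Proof. by move=> ea; apply: psum_unique; exact: cvg_pseriesZ. Qed.

Lemma is_cvg_series_shiftS (u : nat -> R) :
  cvgn (series u) -> cvgn (series (fun k => u k.+1)).
Proof.
move=> cu; rewrite (_ : series _ = (fun n => series u n.+1 - u 0%N)).
  apply: is_cvgB; last exact: is_cvg_cst.
  by apply/cvg_ex; exists (limn (series u)); rewrite cvg_shiftS.
by apply/funext => n; rewrite /series/= big_nat_recl// addrC addKr.
Qed.

Lemma entire_diffs a : entire a -> entire (pseries_diffs a).
Proof.
move=> ea; apply: entire_norm_cvg => x.
(* The series at [2 * X], shifted by one index, dominates: [k.+1 <= 2 ^ k.+1] absorbs the factor
   produced by differentiation. *)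
pose X := 1 + `|x|.
have X1 : 1 <= X by rewrite lerDl.
have X0 : 0 <= X by exact: le_trans X1.
have h := entire_norm (x := 2 * X) ea.
apply: (@series_le_cvg R _ (fun k => `|a k.+1 * (2 * X) ^+ k.+1|)) => // [k|].
  have -> : `|pseries_diffs a k * x ^+ k| = `|a k.+1| * (k.+1%:R * `|x| ^+ k).
    by rewrite /pseries_diffs !normrM normr_nat normrX; ring.
  rewrite normrM ler_wpM2l// ger0_norm ?exprn_ge0 ?mulr_ge0// exprMn ler_pM//.
    by rewrite -natrX ler_nat ltnW// ltn_expl.
  apply: (@le_trans _ _ (X ^+ k)); last by rewrite ler_weXn2l.
  by rewrite lerXn2r ?nnegrE// lerDr.
exact: (@is_cvg_series_shiftS (fun k => `|a k * (2 * X) ^+ k|) h).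
Qed.

Lemma is_derive_psum a x : entire a ->
  is_derive x 1 (psum a) (psum (pseries_diffs a) x).
Proof.
move=> ea; apply: (@pseries_snd_diffs _ _ (`|x| + 1)).
- exact: ea.
- exact: entire_diffs.
- exact/entire_diffs/entire_diffs.
- by rewrite [ltRHS]ger0_norm ?ltrDl// addr_ge0.
Qed.

Lemma continuous_psum a : entire a -> continuous (psum a).
Proof.
move=> ea x; apply: differentiable_continuous; apply/derivable1_diffP.
by have [] := is_derive_psum x ea.
Qed.

Lemma is_derive_psumN a x : entire a ->
  is_derive x 1 (fun z => psum a (- z)) (- psum (pseries_diffs a) (- x)).
Proof.
move=> ea; have h := is_derive_psum (- x) ea.
have := is_derive1_comp h (is_deriveN (is_derive_id x (1 : R))).
by move=> /is_derive_eq; apply; rewrite mulrN1.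
Qed.

Lemma psum0 a : psum a 0 = a 0%N.
Proof.
apply: psum_unique; apply: cvg_near_cst; exists 1%N => // n /= n1.
rewrite /pseries /series/= -(subnKC n1) addSn add0n big_nat_recl// expr0 mulr1.
by rewrite big1 ?addr0// => k _; rewrite expr0n mulr0.
Qed.

Lemma nneg_at_negD a b : entire a -> entire b -> nneg_at_neg a -> nneg_at_neg b ->
  nneg_at_neg (fun k => a k + b k).
Proof. by move=> ea eb pa pb z z0; rewrite psumD// addr_ge0 ?pa ?pb. Qed.

Lemma nneg_at_negZ (c : R) a : 0 <= c -> entire a -> nneg_at_neg a ->
  nneg_at_neg (fun k => c * a k).
Proof. by move=> c0 ea pa z z0; rewrite psumZ// mulr_ge0 ?pa. Qed.

Lemma entire_div a (y c : R) : 0 < y -> 0 <= c -> entire a ->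
  entire (fun k => a k / (y + c * k%:R)).
Proof.
move=> y0 c0 ea; apply: (entire_le (entireZ (c := y^-1) ea)) => k.
rewrite mulrC normrM normrM ler_wpM2r// ger0_norm; last first.
  by rewrite invr_ge0 addr_ge0 ?mulr_ge0// ltW.
rewrite ger0_norm ?invr_ge0 ?(ltW y0)// lef_pV2 ?posrE//.
  by rewrite lerDl mulr_ge0.
by rewrite ltr_wpDr// mulr_ge0.
Qed.

(** Coefficientwise [a k = (y + c * k) * b k], and the [k * b k] are the coefficients of x b'(x):
    the Euler operator y + c x d/dx undoes the division. *)
Lemma psum_div a (y c : R) x : 0 < y -> 0 < c -> entire a ->
  let b k := a k / (y + c * k%:R) in
  psum a x = y * psum b x + c * (x * psum (pseries_diffs b) x).
Proof.
move=> y0 c0 ea b; have eb : entire b by apply: entire_div => //; exact: ltW.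
have edb := entire_diffs eb.
apply: psum_unique.
rewrite (_ : pseries a x = (fun n => y * pseries b x n +
    c * (x * series (fun i => i%:R * b i * x ^+ i.-1) n))); last first.
  apply/funext => n; rewrite /pseries /series/= !mulr_sumr -big_split/=.
  apply: eq_bigr => k _.
  have -> : c * (x * (k%:R * b k * x ^+ k.-1)) = c * k%:R * b k * x ^+ k.
    by case: k => [|k]; rewrite ?mulr0 ?mul0r ?mulr0// exprS /=; ring.
  rewrite mulrA -mulrDl -mulrDl /b mulrCA divff ?mulr1//.
  by rewrite gt_eqF// ltr_wpDr// mulr_ge0// ltW.
apply: cvgD; apply: cvgM; [exact: cvg_cst|exact: pseries_cvg|exact: cvg_cst|].
apply: cvgM; first exact: cvg_cst.
by apply: pseries_diffs_equiv; exact: edb.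
Qed.

(* [w z = z `^ (y / c) * psum a' (- z)], with [a'] the divided sequence, has
   derivative [z `^ (y / c - 1) / c * psum a (- z)]. *)
Lemma nneg_at_neg_div a (y c : R) : 0 < y -> 0 < c -> entire a ->
  nneg_at_neg a -> nneg_at_neg (fun k => a k / (y + c * k%:R)).
Proof.
move=> y0 c0 ea pa z; set b := fun k => _.
have eb : entire b by apply: entire_div => //; exact: ltW.
rewrite le_eqVlt => /predU1P[<-|z0].
  rewrite oppr0 psum0 /b mulr0 addr0 divr_ge0 ?(ltW y0)//.
  by have := pa 0 (lexx _); rewrite oppr0 psum0.
pose q := y / c; have q0 : 0 < q by rewrite divr_gt0.
pose w t := t `^ q * psum b (- t).
have cG : continuous (fun t : R => psum b (- t)).
  by move=> t; apply: continuous_comp; [exact: opp_continuous|exact: continuous_psum].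
have dw (t : R) : 0 < t -> is_derive t 1 w (t `^ (q - 1) / c * psum a (- t)).
  move=> t0; have tI : t \in `]0, +oo[ by rewrite in_itv/= t0.
  have dp : is_derive t 1 (fun u : R => u `^ q) (q * t `^ (q - 1)).
    apply: DeriveDef; first exact: derivable_powR.
    by rewrite -derive1E powR_derive1.
  apply: (is_derive_eq (is_deriveM dp (is_derive_psumN t eb))).
  rewrite (psum_div (- t) y0 c0 ea) -/b /GRing.scale/=.
  have -> : t `^ q = t * t `^ (q - 1) by rewrite mulr_powRB1// ltW.
  rewrite /q; field; lra.
have w0 : w 0 = 0 by rewrite /w powR0 ?mul0r// gt_eqF.
have : w 0 <= w z.
  apply: (@ger0_derive1_ndecr R w 0 z) => //; last exact: ltW.
  - by move=> t; rewrite in_itv/= => /andP[t0 _]; have [] := dw t t0.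
  - move=> t; rewrite in_itv/= => /andP[t0 _]; rewrite derive1E.
    have [_ ->] := dw t t0.
    by rewrite mulr_ge0 ?divr_ge0 ?powR_ge0 ?(ltW c0)// pa// ltW.
  - apply/continuous_within_itvP => //; split.
    + move=> t; rewrite in_itv/= => /andP[t0 _].
      by apply: cvgM; [exact: continuous_powR_gt0|exact: cG].
    + apply: cvgM; first by apply: powR_at_right0; exact: ltW.
      by apply: cvg_at_right_filter; exact: cG.
    + apply: cvgM; apply: cvg_at_left_filter; [exact: continuous_powR_gt0|exact: cG].
by rewrite w0 /w pmulr_rge0// powR_gt0.
Qed.

(** The terms of [A] at [z] dominate those of [a] at [- z], so the difference [D] of the partial
    sums is nondecreasing and lies below its limit. *)
Lemma pseries_ge_tail a A z n : entire A -> (forall k, `|a k| <= A k) -> 0 <= z ->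
  psum a (- z) - (psum A z - pseries A z n) <= pseries a (- z) n.
Proof.
move=> eA aA z0.
have ea : entire a by apply: (entire_le eA) => k; rewrite (le_trans (aA k))// ler_norm.
pose D := pseries A z - pseries a (- z).
have cD : D @ \oo --> psum A z - psum a (- z) by apply: cvgB; exact: pseries_cvg.
have : D n <= limn D.
  apply: nondecreasing_cvgn_le; last by apply/cvg_ex; eexists; exact: cD.
  apply/nondecreasing_seqP => m; rewrite /D !fctE.
  rewrite /pseries /series/= !big_nat_recr//= -subr_ge0.
  set S1 := \sum_(_ <= _ < _) _; set S2 := \sum_(_ <= _ < _) _.
  have : `|a m * (- z) ^+ m| <= A m * z ^+ m.
    by rewrite normrM normrX normrN (ger0_norm z0) ler_wpM2r ?exprn_ge0.
  by rewrite ler_norml => /andP[_]; lra.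
by rewrite (cvg_lim _ cD)// /D !fctE; lra.
Qed.

(** Dominated convergence for series. The partial sums of length [K] of [u n] are bounded below by
    minus the tail of [A], uniformly in [n]. Letting first [n] and then [K] tend to infinity removes
    the tail. *)
Lemma nneg_at_neg_lim (u : nat -> nat -> R) a A : entire A ->
  (forall n k, `|u n k| <= A k) -> (forall k, u n k @[n --> \oo] --> a k) ->
  (forall n, nneg_at_neg (u n)) -> nneg_at_neg a.
Proof.
move=> eA uA ua pu z z0.
have aA k : `|a k| <= A k.
  have h : `|u n k| @[n --> \oo] --> `|a k| by apply: cvg_norm; exact: ua.
  by rewrite -(cvg_lim _ h)//; apply: limr_le; [apply/cvg_ex; eexists; exact: h|apply: nearW].
have ea : entire a by apply: (entire_le eA) => k; rewrite (le_trans (aA k))// ler_norm.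
have hK K : - (psum A z - pseries A z K) <= pseries a (- z) K.
  have h : pseries (u n) (- z) K @[n --> \oo] --> pseries a (- z) K.
    rewrite /pseries /series/=; apply: cvg_big => [|k _]; first exact: add_continuous.
    by apply: cvgM; [exact: ua|exact: cvg_cst].
  rewrite -(cvg_lim _ h)//; apply: limr_ge; first by apply/cvg_ex; eexists; exact: h.
  apply: nearW => n; apply: le_trans (pseries_ge_tail K eA (uA n) z0).
  by rewrite lerDr pu.
have hA : - (psum A z - pseries A z K) @[K --> \oo] --> (0 : R).
  rewrite -[X in _ --> X]oppr0 -(subrr (psum A z)); apply: cvgN; apply: cvgB; first exact: cvg_cst.
  exact: pseries_cvg.
apply: (ler_cvg_to hA (pseries_cvg (x := - z) ea)).
exact: nearW.
Qed.

End entire_power_series.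

(** * Power series nonnegative and nonincreasing along the negative axis *)

Section decreasing_power_series.
Context {R : realType}.
Implicit Types (a b A : nat -> R) (x y z c s : R).

(** Monotonicity is encoded as nonnegativity of the derived series, because [psum a (- z)] has
    derivative [- psum (pseries_diffs a) (- z)] in [z]. Closure properties then reduce to those of
    [nneg_at_neg], used for [a] and for its derived sequence. *)
Definition decr_at_neg a :=
  [/\ entire a, nneg_at_neg a & nneg_at_neg (pseries_diffs a)].

Lemma decr_at_neg_ext a b : a =1 b -> decr_at_neg a -> decr_at_neg b.
Proof. by move=> /funext ->. Qed.

Lemma decr_at_negZ c a : 0 <= c -> decr_at_neg a -> decr_at_neg (fun k => c * a k).
Proof.
move=> c0 [ea pa pda]; split; [exact: entireZ|exact: nneg_at_negZ|].
rewrite (_ : pseries_diffs _ = (fun k => c * pseries_diffs a k)).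
  by apply: nneg_at_negZ => //; exact: entire_diffs.
by apply/funext => k; rewrite /pseries_diffs mulrCA.
Qed.

(** The product is [a k + s * (a k / (y + c * k))], to which [nneg_at_neg_div] applies.
    Differentiation shifts the index by one, which gives the same kind of multiplier with [y + c] in
    place of [y]. *)
Lemma decr_at_neg_mul1D a y c s : 0 < y -> 0 < c -> 0 <= s -> decr_at_neg a ->
  decr_at_neg (fun k => a k * (1 + s / (y + c * k%:R))).
Proof.
have main b y' : 0 < y' -> 0 < c -> 0 <= s -> entire b -> nneg_at_neg b ->
    entire (fun k => b k * (1 + s / (y' + c * k%:R))) /\
    nneg_at_neg (fun k => b k * (1 + s / (y' + c * k%:R))).
  move=> y0 c0 s0 eb pb.
  have -> : (fun k => b k * (1 + s / (y' + c * k%:R))) =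
      (fun k => b k + s * (b k / (y' + c * k%:R))).
    by apply/funext => k; ring.
  have ed : entire (fun k => s * (b k / (y' + c * k%:R))).
    by apply: entireZ; apply: entire_div => //; exact: ltW.
  split; first exact: entireD.
  apply: nneg_at_negD => //; apply: nneg_at_negZ => //; last exact: nneg_at_neg_div.
  by apply: entire_div => //; exact: ltW.
move=> y0 c0 s0 [ea pa pda]; have [e p] := main a y y0 c0 s0 ea pa; split=> //.
have yc : 0 < y + c by rewrite addr_gt0.
have [_ p'] := main _ _ yc c0 s0 (entire_diffs ea) pda.
rewrite (_ : pseries_diffs _ = fun k => pseries_diffs a k * (1 + s / (y + c + c * k%:R)))//.
apply/funext => k; rewrite /pseries_diffs mulrA; congr (_ * (1 + s / _)).
by rewrite -natr1; ring.
Qed.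

Lemma decr_at_neg_lim (u : nat -> nat -> R) a A : entire A ->
  (forall n k, `|u n k| <= A k) -> (forall k, u n k @[n --> \oo] --> a k) ->
  (forall n, decr_at_neg (u n)) -> decr_at_neg a.
Proof.
move=> eA uA ua du.
have aA k : `|a k| <= A k.
  have h : `|u n k| @[n --> \oo] --> `|a k| by apply: cvg_norm; exact: ua.
  by rewrite -(cvg_lim _ h)//; apply: limr_le; [apply/cvg_ex; eexists; exact: h|apply: nearW].
split.
- by apply: (entire_le eA) => k; rewrite (le_trans (aA k))// ler_norm.
- by apply: (nneg_at_neg_lim eA uA ua) => n; have [] := du n.
- apply: (nneg_at_neg_lim (u := fun n => pseries_diffs (u n)) (entire_diffs eA)).
  + by move=> n k; rewrite /pseries_diffs normrM normr_nat ler_wpM2l.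
  + by move=> k; apply: cvgM; [exact: cvg_cst|exact: ua].
  + by move=> n; have [] := du n.
Qed.

Lemma psum_exp c x : psum (fun k => c ^+ k / k`!%:R) x = expR (c * x).
Proof.
rewrite /psum expRE; congr (lim (_ @ \oo)).
apply/funext => n; apply: eq_bigr => k _.
by rewrite /= exprMn; ring.
Qed.

Lemma entire_exp c : entire (fun k => c ^+ k / k`!%:R).
Proof.
move=> x; have := is_cvg_series_exp_coeff (c * x); rewrite exp_coeffE.
rewrite (_ : pseries _ x = series (fun n => (n`!%:R)^-1 * (c * x) ^+ n))//.
by apply/funext => n; apply: eq_bigr => k _; rewrite /= exprMn; ring.
Qed.

Lemma decr_at_neg_exp c : 0 <= c -> decr_at_neg (fun k => c ^+ k / k`!%:R).
Proof.
move=> c0; have pe : nneg_at_neg (fun k => c ^+ k / k`!%:R).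
  by move=> z z0; rewrite psum_exp expR_ge0.
split=> //; first exact: entire_exp.
rewrite (_ : pseries_diffs _ = (fun k => c * (c ^+ k / k`!%:R))).
  by apply: nneg_at_negZ => //; exact: entire_exp.
apply/funext => k; rewrite /pseries_diffs factS natrM exprS.
have f0 : k`!%:R != 0 :> R by rewrite pnatr_eq0 -lt0n fact_gt0.
by field; rewrite f0 /= nat1r pnatr_eq0.
Qed.

Lemma decr_at_neg_le a z1 z2 : decr_at_neg a -> z1 <= z2 -> 0 <= z1 ->
  psum a (- z2) <= psum a (- z1).
Proof.
move=> [ea pa pda] z12 z10.
have cG : continuous (fun t : R => psum a (- t)).
  by move=> t; apply: continuous_comp; [exact: opp_continuous|exact: continuous_psum].
have := @ler0_derive1_nincry R (fun t => psum a (- t)) 0; apply => //.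
- by move=> t _; have [] := is_derive_psumN t ea.
- move=> t; rewrite in_itv/= andbT => t0; rewrite derive1E.
  by have [_ ->] := is_derive_psumN t ea; rewrite oppr_le0 pda// ltW.
- exact: continuous_subspaceT.
Qed.

(* The derivative at [0] is [- a 1 < 0]. *)
Lemma decr_at_neg_lt a z0 : decr_at_neg a -> 0 < a 1%N -> 0 < z0 ->
  exists2 e : R, 0 < e & forall z, z0 <= z -> psum a (- z) <= a 0%N - e.
Proof.
move=> da a1 z00; have [ea pa pda] := da.
exists (a 0%N - psum a (- z0)); last first.
  by move=> z z0z; rewrite opprB addrC subrK decr_at_neg_le// ltW.
have cd := continuous_psum (entire_diffs ea) (x := 0).
have d0 : psum (pseries_diffs a) 0 = a 1%N.
  by rewrite psum0 /pseries_diffs mul1r.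
have [e /= e0 he] : exists2 e : R, 0 < e & forall t, `|t| < e -> 0 < psum (pseries_diffs a) t.
  have := cvgr_gt _ cd 0; rewrite d0 => /(_ _ a1) /nbhs_ballP [e /= e0 he].
  by exists e => // t te; apply: he; rewrite /ball/= sub0r normrN.
pose z1 := Num.min z0 (e / 2).
have z10 : 0 < z1 by rewrite lt_min z00 divr_gt0.
have z1e : z1 < e by rewrite (@le_lt_trans _ _ (e / 2)) ?ge_min ?lexx ?orbT//; lra.
have z1z0 : z1 <= z0 by rewrite ge_min lexx.
have cG : continuous (fun t : R => psum a (- t)).
  by move=> t; apply: continuous_comp; [exact: opp_continuous|exact: continuous_psum].
have [t /=] := @MVT R (fun t => psum a (- t)) (fun t => - psum (pseries_diffs a) (- t)) 0 z1
  z10 (fun t _ => is_derive_psumN t ea) (continuous_subspaceT cG).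
rewrite in_itv/= oppr0 psum0 addr0 => /andP[t0 tz1] eq1.
have h1 : 0 < psum (pseries_diffs a) (- t).
  by apply: he; rewrite normrN gtr0_norm// (lt_trans tz1).
have h2 := decr_at_neg_le da z1z0 (ltW z10).
have h3 : 0 < psum (pseries_diffs a) (- t) * z1 by rewrite mulr_gt0.
by lra.
Qed.
End decreasing_power_series.

(** * Quotients of Gamma values *)

Section Gamma_ratio.
Context {R : realType}.
Implicit Types (s y d c : R).

(* [Gamma (y + s) / Gamma y], with arguments of [Gamma] at least 1 even for
   small [y]. *)
Definition Gamma_ratio s y := y * Gamma (y + s) / Gamma (y + 1).

Lemma Gamma_ratio_gt0 s y : 0 < y -> 1 <= y + s -> 0 < Gamma_ratio s y.
Proof.
move=> y0 ys; rewrite /Gamma_ratio divr_gt0 ?mulr_gt0 ?Gamma_gt0//; lra.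
Qed.

Lemma Gamma_ratioS s y : 0 < y -> 1 <= y + s ->
  Gamma_ratio s (y + 1) = Gamma_ratio s y * (1 + s / y).
Proof.
move=> y0 ys; rewrite /Gamma_ratio.
have y1 : 1 <= y + 1 by lra.
have -> : y + 1 + s = y + s + 1 by ring.
rewrite (GammaS ys) (GammaS y1).
have g0 : Gamma (y + 1) != 0 by rewrite gt_eqF// Gamma_gt0.
have y_neq0 : y != 0 by rewrite gt_eqF.
have y1_neq0 : y + 1 != 0 by rewrite gt_eqF// addr_gt0.
move: (Gamma (y + 1)) (Gamma (y + s)) g0 => G H G0.
by field; rewrite G0 y_neq0 y1_neq0.
Qed.

Lemma Gamma_ratioDn s y n : 0 < y -> 1 <= y + s ->
  Gamma_ratio s (y + n%:R) = Gamma_ratio s y * \prod_(j < n) (1 + s / (y + j%:R)).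
Proof.
move=> y0 ys; elim: n => [|n IH]; first by rewrite big_ord0 addr0 mulr1.
rewrite -natr1 addrA Gamma_ratioS ?IH ?big_ord_recr /= ?mulrA//.
  by rewrite ltr_wpDr.
by rewrite addrAC (le_trans ys)// lerDl.
Qed.

(* The shift [d = y' - y] and [c ^ s = Gamma (y + s) / Gamma y] in the
   Chebyshev inequality. *)
Lemma Gamma_ratio_le s y y' : 0 <= s -> 1 <= y -> y <= y' -> Gamma_ratio s y <= Gamma_ratio s y'.
Proof.
move=> s0 y1 yy'.
have Gr z : 1 <= z -> Gamma_ratio s z = Gamma (z + s) / Gamma z.
  move=> z1; have z_neq0 : z != 0 by rewrite gt_eqF// (lt_le_trans ltr01).
  by rewrite /Gamma_ratio (GammaS z1) -mulf_div divff ?mul1r.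
have y'1 : 1 <= y' by exact: le_trans yy'.
rewrite (Gr _ y1) (Gr _ y'1).
have g0 : 0 < Gamma y by exact: Gamma_gt0.
have gs0 : 0 < Gamma (y + s) by apply: Gamma_gt0; rewrite (le_trans y1)// lerDl.
have g'0 : 0 < Gamma y' by apply: Gamma_gt0.
have d0 : 0 <= y' - y by rewrite subr_ge0.
have cheb c : 0 < c -> c `^ (y' - y) * Gamma (y + s) + c `^ s * Gamma y' <=
    Gamma (y' + s) + c `^ s * c `^ (y' - y) * Gamma y.
  move=> c0; have := Gamma_chebyshev y1 s0 d0 c0.
  have -> : y + s + (y' - y) = y' + s by ring.
  have -> : y + (y' - y) = y' by ring.
  by rewrite (@powRD _ c s (y' - y)) ?(gt_eqF c0) ?implybT.
have [e|s_neq0] := eqVneq s 0.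
  by rewrite e !addr0 (divff (lt0r_neq0 g0)) (divff (lt0r_neq0 g'0)).
move: (Gamma y) (Gamma (y + s)) (Gamma y') (Gamma (y' + s)) g0 gs0 g'0 cheb {Gr}.
move=> G Gs G' G's g0 gs0 g'0 cheb.
have r0 : 0 < Gs / G by rewrite divr_gt0.
pose c := (Gs / G) `^ s^-1.
have c0 : 0 < c by exact: powR_gt0.
have cs : c `^ s = Gs / G by rewrite /c -powRrM mulVf ?powRr1 ?(ltW r0).
have := cheb c c0; rewrite cs.
have -> : Gs / G * c `^ (y' - y) * G = c `^ (y' - y) * Gs.
  by rewrite mulrAC mulfVK ?gt_eqF// mulrC.
by rewrite addrC lerD2r ler_pdivlMr.
Qed.

(** By monotonicity [d] may be replaced with the integer [K]; then [Gamma_ratioDn] yields [K]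
    factors, each at most [1 + s / y]. *)
Lemma Gamma_ratio_quot_ge s y d K : 0 <= s -> 1 <= y -> 0 <= d -> d <= K%:R ->
  ((1 + s / y) ^+ K)^-1 <= Gamma_ratio s y / Gamma_ratio s (y + d).
Proof.
move=> s0 y1 d0 dK.
have r0 z : 1 <= z -> 0 < Gamma_ratio s z by move=> z1; apply: Gamma_ratio_gt0; lra.
have yd1 : 1 <= y + d by lra.
have sy : 0 <= s / y by rewrite divr_ge0//; lra.
have p0 : 0 < (1 + s / y) ^+ K by rewrite exprn_gt0//; lra.
rewrite ler_pdivlMr ?r0// mulrC ler_pdivrMr//.
apply: (@le_trans _ _ (Gamma_ratio s (y + K%:R))); first by apply: Gamma_ratio_le => //; lra.
rewrite Gamma_ratioDn; [|lra|lra].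
rewrite ler_wpM2l ?(ltW (r0 _ _))//.
rewrite -[X in _ <= _ ^+ X]card_ord -prodr_const; apply: ler_prod => j _.
have j0 : 0 <= j%:R :> R by [].
have yj : 0 < y + j%:R by lra.
apply/andP; split; first by rewrite addr_ge0// divr_ge0// ltW.
by rewrite lerD2l ler_wpM2l// lef_pV2 ?posrE//; lra.
Qed.

(** Once [y + c * n >= 1], the quotient is at most one by monotonicity and at least the inverse of
    [(1 + s / (y + c * n)) ^+ K]. This lower bound tends to one because the integer [K >= d] is
    fixed. *)
Lemma cvg_Gamma_ratio_quot s y c d : 0 <= s -> 0 < y -> 0 < c -> 0 <= d ->
  Gamma_ratio s (y + c * n%:R) / Gamma_ratio s (y + c * n%:R + d) @[n --> \oo] --> (1 : R).
Proof.
move=> s0 y0 c0 d0.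
pose K := (Num.truncn d).+1.
have dK : d <= K%:R.
  by apply: ltW; have := real_truncnS_gt (num_real d).
apply: (@squeeze_cvgr _ _ _ _ (fun n => ((1 + s / (y + c * n%:R)) ^+ K)^-1) (fun=> 1)).
- near=> n.
  have yn : 1 <= y + c * n%:R.
    have : c^-1 <= n%:R by near: n; exact: nbhs_infty_ger.
    by rewrite -[c^-1]mulr1 ler_pdivrMl//; lra.
  rewrite Gamma_ratio_quot_ge//= ler_pdivrMr ?mul1r; last by apply: Gamma_ratio_gt0; lra.
  by apply: Gamma_ratio_le => //; lra.
- have cy : y + c * n%:R @[n --> \oo] --> +oo.
    apply/cvgryPge => M; near=> n.
    have : (M - y) / c <= n%:R by near: n; exact: nbhs_infty_ger.
    by rewrite ler_pdivrMr// mulrC lerBlDl.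
  have cV : (y + c * n%:R)^-1 @[n --> \oo] --> (0 : R).
    by apply/gtr0_cvgV0 => //; apply: nearW => n; rewrite ltr_wpDr// mulr_ge0// ltW.
  have c1 : 1 + s / (y + c * n%:R) @[n --> \oo] --> (1 : R).
    rewrite -[X in _ --> X]addr0 -[X in _ --> _ + X](mulr0 s).
    by apply: cvgD; [exact: cvg_cst|apply: cvgM => //; exact: cvg_cst].
  have := cvg_comp _ _ c1 (@exprn_continuous R K 1); rewrite expr1n => cX.
  rewrite -[X in _ --> X]invr1 /=; apply: cvgV; first exact: oner_neq0.
  exact: cX.
- exact: cvg_cst.
Unshelve. all: by end_near. Qed.

End Gamma_ratio.

(** * Kilbas-Saigo functions *)

(** Gauss's product: by [Gamma_ratioDn], the product in [u n k] is the multiplier of the statement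
    times [Gamma_ratio s (a + c * k + n) / Gamma_ratio s (a + n)], which tends to one. Up to a
    positive constant each factor is a multiplier of [decr_at_neg_mul1D], and it is at most one, so
    the absolute values of [f] dominate. *)
Lemma decr_at_neg_Gamma_ratio (R : realType) (s a c : R) (f : nat -> R) :
  0 <= s -> 0 < a -> 1 <= a + s -> 0 < c -> decr_at_neg f ->
  decr_at_neg (fun k => f k * (Gamma_ratio s a / Gamma_ratio s (a + c * k%:R))).
Proof.
move=> s0 a0 as1 c0 df.
pose u n k := f k * \prod_(j < n)
  ((1 + s / (a + c * k%:R + j%:R)) / (1 + s / (a + j%:R))).
have pos (b : R) : 0 < b -> 0 < 1 + s / b.
  by move=> b0; rewrite ltr_wpDr// divr_ge0// ltW.
have ck k : 0 <= c * k%:R by rewrite mulr_ge0// ltW.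
have aj (j : nat) : 0 < a + j%:R by rewrite ltr_wpDr.
have akj k (j : nat) : 0 < a + c * k%:R + j%:R by rewrite addrAC ltr_wpDr.
have du n : decr_at_neg (u n).
  elim: n => [|n IH].
    by apply: decr_at_neg_ext df => k; rewrite /u big_ord0 mulr1.
  have := decr_at_negZ (ltW (_ : 0 < (1 + s / (a + n%:R))^-1))
    (decr_at_neg_mul1D (aj n) c0 s0 IH).
  rewrite invr_gt0 => /(_ (pos _ (aj n))); apply: decr_at_neg_ext => k.
  rewrite /u big_ord_recr/= (addrAC a); ring.
have u_le n k : `|u n k| <= `|f k|.
  rewrite /u normrM -[leRHS]mulr1 ler_wpM2l//.
  rewrite ger0_norm; last by apply: prodr_ge0 => j _; rewrite divr_ge0// ltW// pos.
  rewrite -[leRHS](expr1n _ n) -[X in _ <= _ ^+ X]card_ord -prodr_const.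
  apply: ler_prod => j _; rewrite divr_ge0 ?(ltW (pos _ _))//=.
  rewrite ler_pdivrMr ?pos// mul1r lerD2l ler_wpM2l// lef_pV2 ?posrE//.
  by rewrite lerD2r lerDl.
apply: (decr_at_neg_lim (u := u) (A := fun k => `|f k|)) => //.
  by case: df => ef _ _; apply: (entire_le ef) => k; rewrite normr_id.
move=> k; apply: cvgM; first exact: cvg_cst.
have r0 z : 0 < z -> 1 <= z + s -> Gamma_ratio s z != 0.
  by move=> z0 zs; rewrite gt_eqF// Gamma_ratio_gt0.
have ak0 : 0 < a + c * k%:R by rewrite ltr_wpDr.
have ak1 : 1 <= a + c * k%:R + s by rewrite addrAC (le_trans as1)// lerDl.
have h := cvg_Gamma_ratio_quot s0 a0 ltr01 (ck k).
have {}h : (Gamma_ratio s (a + 1 * n%:R) / Gamma_ratio s (a + 1 * n%:R + c * k%:R))^-1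
    @[n --> \oo] --> (1 : R).
  by rewrite -[X in _ --> X]invr1 /=; apply: cvgV; [exact: oner_neq0|exact: h].
rewrite -[X in _ --> X]mulr1.
apply: cvg_trans (cvgM (cvg_cst (Gamma_ratio s a / Gamma_ratio s (a + c * k%:R))) h).
apply: near_eq_cvg; apply: nearW => n /=.
rewrite mul1r (addrAC a) (Gamma_ratioDn _ a0 as1) (Gamma_ratioDn _ ak0 ak1).
rewrite prodf_div.
have p1 : \prod_(j < n) (1 + s / (a + j%:R)) != 0.
  by rewrite gt_eqF// prodr_gt0// => j _; rewrite pos.
have p2 : \prod_(j < n) (1 + s / (a + c * k%:R + j%:R)) != 0.
  by rewrite gt_eqF// prodr_gt0// => j _; rewrite pos.
move: (r0 _ a0 as1) (r0 _ ak0 ak1) p1 p2.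
move: (Gamma_ratio s a) (Gamma_ratio s (a + c * k%:R)) => G1 G2.
move: (\prod_(j < n) _) (\prod_(j < n) _) => P1 P2 *.
by field; apply/and4P; split.
Qed.

Lemma entire_ratio (R : realType) (a q : nat -> R) :
  (forall k, a k.+1 = a k * q k) -> q @ \oo --> (0 : R) -> entire a.
Proof.
move=> aq q0; apply: entire_norm_cvg => x.
have [N _ hN] : \forall k \near \oo, `|q k * x| <= 2^-1.
  have : `|q k * x| @[k --> \oo] --> (0 : R).
    rewrite -(normr0 R) -(mul0r x); apply: cvg_norm; apply: cvgM => //; exact: cvg_cst.
  by move=> /cvgr_le; apply; lra.
(* From index [N] on, the ratios of consecutive terms are at most one half. The weights [2 ^+ i]
   make [M * 2^-1 ^+ k] a bound for all [k <= N] at once, and the recurrence then propagates it. *)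
pose M := \sum_(i < N.+1) `|a i * x ^+ i| * 2 ^+ i.
have M0 : 0 <= M by apply: sumr_ge0 => i _; rewrite mulr_ge0// exprn_ge0.
have bd k : `|a k * x ^+ k| <= M * 2^-1 ^+ k.
  elim: k => [|k IH].
    rewrite /M (bigD1 ord0)//= !expr0 !mulr1 lerDl.
    by apply: sumr_ge0 => i _; rewrite mulr_ge0// exprn_ge0.
  have [kN|Nk] := ltnP k N.
    rewrite exprVn ler_pdivlMr ?exprn_gt0// /M.
    rewrite (bigD1 (Ordinal (kN : (k.+1 < N.+1)%N)))//= lerDl.
    by apply: sumr_ge0 => i _; rewrite mulr_ge0// exprn_ge0.
  have -> : a k.+1 * x ^+ k.+1 = (a k * x ^+ k) * (q k * x) by rewrite aq exprS; ring.
  by rewrite normrM exprSr mulrA ler_pM// hN.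
apply: (@series_le_cvg R _ (geometric M 2^-1)) => //.
- by move=> n; rewrite /geometric/= mulr_ge0// exprn_ge0.
- by apply: is_cvg_geometric_series; rewrite ger0_norm; lra.
Qed.

Lemma psum_recl (R : realType) (a : nat -> R) (x : R) :
  entire a -> entire (fun k => a k.+1) ->
  psum a x = a 0%N + x * psum (fun k => a k.+1) x.
Proof.
move=> ea eS; apply: psum_unique; rewrite -cvg_shiftS.
rewrite (_ : (fun n => pseries a x n.+1) =
    (fun n => a 0%N + x * pseries (fun k => a k.+1) x n)).
  apply: cvgD; first exact: cvg_cst.
  by apply: cvgM; [exact: cvg_cst|exact: pseries_cvg].
apply/funext => n; rewrite /pseries /series/= big_nat_recl// expr0 mulr1 mulr_sumr.
by congr (_ + _); apply: eq_bigr => k _; rewrite exprS mulrCA.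
Qed.

(* Both [\prod_(i < n) p i * \prod_(i < k) p (n + i)] and
   [\prod_(i < k) p i * \prod_(i < n) p (i + k)] are [\prod_(i < n + k) p i]. *)
Lemma prod_quot_shift (F : fieldType) (p : nat -> F) n k : (forall i, p i != 0) ->
  \prod_(i < n) (p i / p (i + k)%N) =
  \prod_(i < k) p i / \prod_(i < k) p (n + i)%N.
Proof.
move=> p0; have nz m (h : nat -> nat) : \prod_(i < m) p (h i) != 0.
  by apply/prodf_neq0 => i _; exact: p0.
have T m k' : \prod_(i < m + k') p i = \prod_(i < m) p i * \prod_(i < k') p (m + i)%N.
  by rewrite big_split_ord.
rewrite prodf_div; apply/eqP; rewrite eqr_div ?(nz _ (addn n)) ?(nz _ (addn^~ k))//.
rewrite -T addnC T; apply/eqP; congr (_ * _).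
by apply: eq_bigr => i _; rewrite addnC.
Qed.

(** * Two-sided bound on the symbol of K *)

Section Kilbas_Saigo_bounds.
Context {R : realType}.
Variables alpha beta : R.
Hypotheses (alpha01 : 0 < alpha <= 1) (beta0 : 0 <= beta).
Let gam := alpha + beta.
Let s := 1 - alpha.

(** [c] is the coefficient sequence of F = E_(alpha, m, m - 1) with m = 1 + beta / alpha, and [q]
    gives the quotients of consecutive coefficients. The function occurring in [sigma] has the
    coefficients [d] introduced below. *)
Let q (j : nat) : R := Gamma (gam * j%:R + beta + 1) / Gamma (gam * j.+1%:R + 1).
Let c (k : nat) : R := \prod_(j < k) q j.

Let q_gt0 j : 0 < q j.
Proof.
have /andP[a0 a1] := alpha01.
have g0 : 0 <= gam by rewrite addr_ge0// ltW.
by rewrite divr_gt0// Gamma_gt0// lerDr ?addr_ge0 ?mulr_ge0.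
Qed.

(** Chebyshev's inequality with shifts [alpha] and [1] and with [c = y / 2]: after the recurrence
    for [Gamma], half of the term in [Gamma y] survives on the left. The constant 3 comes from
    [y / 2 + alpha <= 3 * (y / 2)], as [alpha <= 1 <= y]. *)
Let q_le (j : nat) (y := gam * j%:R + beta + 1) : q j <= 3 / (y / 2) `^ alpha.
Proof.
have /andP[a0 a1] := alpha01.
have b0 := beta0.
have g0 : 0 <= gam by rewrite addr_ge0// ltW.
have gj : 0 <= gam * j%:R by rewrite mulr_ge0.
have y1 : 1 <= y by rewrite /y; lra.
have y20 : 0 < y / 2 by lra.
have := Gamma_chebyshev y1 (ltW a0) ler01 y20.
have -> : q j = Gamma y / Gamma (y + alpha).
  congr (_ / Gamma _); rewrite /y /gam -natr1; ring.
have ya1 : 1 <= y + alpha by lra.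
rewrite powRr1 ?(ltW y20)// (GammaS ya1) (GammaS y1).
rewrite (@powRD _ (y / 2) alpha 1) ?(gt_eqF y20) ?implybT// powRr1 ?(ltW y20)//.
have p0 : 0 < (y / 2) `^ alpha by rewrite powR_gt0.
have G1 := Gamma_gt0 y1; have G2 := Gamma_gt0 ya1.
move: (Gamma y) (Gamma (y + alpha)) ((y / 2) `^ alpha) G1 G2 p0 => G G' P G0 G'0 P0 h.
rewrite ler_pdivlMr// mulrAC ler_pdivrMr//.
have h2 : P * (y / 2) * G <= (y / 2 + alpha) * G' by lra.
have h3 : (y / 2 + alpha) * G' <= (y / 2) * (3 * G').
  by rewrite [leRHS]mulrA ler_wpM2r ?(ltW G'0)//; lra.
rewrite -(ler_pM2l y20); apply: le_trans h3; apply: le_trans h2.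
by rewrite (_ : y / 2 * (G * P) = P * (y / 2) * G)//; ring.
Qed.

Let q_cvg : q @ \oo --> (0 : R).
Proof.
have /andP[a0 a1] := alpha01.
have g0 : 0 < gam by rewrite ltr_wpDr.
apply/cvgrPdist_le => e e0; near=> j.
rewrite sub0r normrN gtr0_norm ?q_gt0//.
apply: le_trans (q_le j) _.
set y := gam * j%:R + beta + 1.
have yM : (3 / e) `^ alpha^-1 <= y / 2.
  have : 2 * (3 / e) `^ alpha^-1 / gam <= j%:R by near: j; exact: nbhs_infty_ger.
  rewrite ler_pdivrMr// /y mulrC (mulrC _ gam) => h.
  by have b0 := beta0; rewrite ler_pdivlMr//; lra.
have e3 : 0 < 3 / e by rewrite divr_gt0.
have y20 : 0 < y / 2 by apply: lt_le_trans yM; rewrite powR_gt0.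
rewrite ler_pdivrMr ?powR_gt0// mulrC -ler_pdivrMr//.
have -> : 3 / e = ((3 / e) `^ alpha^-1) `^ alpha.
  by rewrite -powRrM mulVf ?powRr1 ?(ltW e3)// gt_eqF.
by apply: ge0_ler_powR; rewrite ?nnegrE ?powR_ge0 ?(ltW a0) ?(ltW y20).
Unshelve. all: by end_near. Qed.

Let entire_c : entire c.
Proof.
by apply: (entire_ratio (q := q)) q_cvg => k; rewrite /c big_ord_recr.
Qed.

(** By [phiE] this is [j.+1 * q j]. The factor [j.+1] makes the products of [phi] equal to k! c_k,
    and it turns the Gamma quotient into a [Gamma_ratio] with parameter [s >= 0], to which
    monotonicity and Gauss's product apply. *)
Let phi (j : nat) : R := Gamma_ratio s (gam * j.+1%:R) / gam.

Let gam_gt0 : 0 < gam.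
Proof. by have /andP[a0 a1] := alpha01; rewrite ltr_wpDr. Qed.

Let div_gam (x y : R) : x / gam / (y / gam) = x / y.
Proof. by rewrite invf_div mulrA mulfVK// gt_eqF// gam_gt0. Qed.

Let s_ge0 : 0 <= s.
Proof. by have /andP[a0 a1] := alpha01; rewrite subr_ge0. Qed.

Let gamS_gt0 j : 0 < gam * j.+1%:R.
Proof. by rewrite mulr_gt0 ?gam_gt0. Qed.

Let gamSDs j : gam * j.+1%:R + s = gam * j%:R + beta + 1.
Proof. by rewrite /s /gam -natr1; ring. Qed.

Let gamSDs_ge1 j : 1 <= gam * j.+1%:R + s.
Proof. by rewrite gamSDs lerDr addr_ge0// mulr_ge0// ltW// gam_gt0. Qed.

Let phi_gt0 j : 0 < phi j.
Proof. by rewrite divr_gt0 ?gam_gt0// Gamma_ratio_gt0. Qed.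

Let phiE j : phi j = j.+1%:R * q j.
Proof.
rewrite /phi /q /Gamma_ratio gamSDs.
have g_neq0 : gam != 0 by rewrite gt_eqF// gam_gt0.
by rewrite [LHS]mulrC !mulrA mulVf// mul1r.
Qed.

Let c_phi k : c k = (\prod_(j < k) phi j) / k`!%:R.
Proof.
elim: k => [|k IH]; first by rewrite /c !big_ord0 divr1.
rewrite /c big_ord_recr/= -/(c k) IH big_ord_recr/= phiE factS natrM.
have f0 : k`!%:R != 0 :> R by rewrite pnatr_eq0 -lt0n fact_gt0.
have k0 : k.+1%:R != 0 :> R by rewrite pnatr_eq0.
by move: k.+1%:R k0 => K K0; field; rewrite f0 K0.
Qed.

(** Coefficients of exp (phi_n x) after [m] multipliers of the kind treated in
    [decr_at_neg_Gamma_ratio]. On the diagonal [m = n] they are [c k] times [k] quotients that tend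
    to one, see [wE]. *)
Let w n m (k : nat) : R := phi n ^+ k / k`!%:R * \prod_(i < m) (phi i / phi (i + k)).

Let decr_w n m : decr_at_neg (w n m).
Proof.
elim: m => [|m IH].
  apply: decr_at_neg_ext (decr_at_neg_exp (ltW (phi_gt0 n))) => k.
  by rewrite /w big_ord0 mulr1.
have := decr_at_neg_Gamma_ratio s_ge0 (gamS_gt0 m) (gamSDs_ge1 m) gam_gt0 IH.
apply: decr_at_neg_ext => k; rewrite /w big_ord_recr/= [RHS]mulrA; congr (_ * _).
have -> : gam * m.+1%:R + gam * k%:R = gam * (m + k).+1%:R.
  by rewrite -mulrDr -natrD addSn.
by rewrite /phi div_gam.
Qed.

Let wE n k : w n n k = c k * \prod_(i < k) (phi n / phi (n + i)).
Proof.
rewrite /w c_phi prod_quot_shift => [|i]; last by rewrite gt_eqF.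
have -> : \prod_(i < k) (phi n / phi (n + i)) = phi n ^+ k / \prod_(i < k) phi (n + i).
  by move: phi => p; rewrite prodf_div prodr_const card_ord.
by rewrite !mulf_div (mulrC (phi n ^+ k)).
Qed.

Let decr_c : decr_at_neg c.
Proof.
(* For [n >= N] the argument [gam * n.+1] is at least one, where [Gamma_ratio] is nondecreasing.
   Hence [w n n k <= c k], and [c] itself dominates the diagonal sequences once they are shifted by
   [N]. *)
pose N := (Num.truncn gam^-1).+1.
have N1 n : 1 <= gam * (n + N).+1%:R.
  rewrite -[gam](invrK) ler_pdivlMl ?invr_gt0 ?gam_gt0// mulr1.
  apply: le_trans (ltW (real_truncnS_gt (num_real _))) _.
  by rewrite ler_nat ltnW// ltnS leq_addl.
have phiD n i : phi (n + i) = Gamma_ratio s (gam * n.+1%:R + gam * i%:R) / gam.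
  by rewrite /phi -mulrDr -natrD addSn.
have phi_le n i : (N <= n)%N -> phi n <= phi (n + i).
  move=> Nn; rewrite phiD /phi ler_wpM2r ?invr_ge0 ?(ltW gam_gt0)//.
  apply: Gamma_ratio_le => //; last by rewrite lerDl mulr_ge0// ltW// gam_gt0.
  by rewrite -(subnK Nn).
have c_ge0 k : 0 <= c k by apply: prodr_ge0 => j _; exact: ltW.
apply: (decr_at_neg_lim (u := fun n => w (n + N) (n + N)) entire_c) => [n k|k|n].
- rewrite wE normrM ger0_norm// ler_piMr//.
  rewrite ger0_norm; last by apply: prodr_ge0 => i _; rewrite divr_ge0// ltW.
  apply: prodr_ile1 => i _; rewrite divr_ge0 ?(ltW (phi_gt0 _))//=.
  by rewrite ler_pdivrMr// mul1r phi_le// leq_addl.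
- have h : w n n k @[n --> \oo] --> c k.
    rewrite (_ : (fun n => w n n k) = (fun n => c k * \prod_(i < k) (phi n / phi (n + i)))); last first.
      by apply/funext => n; exact: wE.
    have h1 : \prod_(i < k) (phi n / phi (n + i)) @[n --> \oo] --> \prod_(i < k) (1 : R).
      apply: cvg_big => [|i _]; first exact: mul_continuous.
      have gi : 0 <= gam * i%:R by rewrite mulr_ge0// ltW// gam_gt0.
      apply: cvg_trans (cvg_Gamma_ratio_quot s_ge0 gam_gt0 gam_gt0 gi).
      apply: near_eq_cvg; apply: nearW => n.
      by rewrite phiD /phi div_gam -natr1 mulrDr mulr1 (addrC gam).
    have := cvgM (cvg_cst (c k)) h1; rewrite big1// mulr1; exact.
  by rewrite (cvg_shiftn N (fun n => w n n k)).
- exact: decr_w.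
Qed.

(** Coefficients of the Kilbas-Saigo function in [sigma]: those of F with the first dropped and the
    next normalized to one. The normalizing factor [q 0] is [eta2]. *)
Let d k := c k.+1 / q 0.

Let dE k : d k = \prod_(j < k) q j.+1.
Proof. by rewrite /d /c big_ord_recl mulrAC divff ?mul1r// gt_eqF. Qed.

Let entire_d : entire d.
Proof.
apply: (entire_ratio (q := fun k => q k.+1)) => [k|]; last by rewrite cvg_shiftS.
by rewrite !dE big_ord_recr.
Qed.

Let psum_d x : psum c x = 1 + x * (q 0 * psum d x).
Proof.
have cS : (fun k => c k.+1) = (fun k => q 0 * d k).
  by apply/funext => k; rewrite /d mulrCA divff ?mulr1// gt_eqF.
rewrite psum_recl//; last by rewrite cS; exact: entireZ.
by rewrite cS psumZ// /c big_ord0.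
Qed.

Let Kilbas_SaigoE x :
  Kilbas_Saigo alpha (1 + beta / alpha) (1 + 2 * beta / alpha) x = psum d x.
Proof.
have /andP[a0 a1] := alpha01.
have a_neq0 : alpha != 0 by rewrite gt_eqF.
have qE (j : nat) : Gamma (alpha * (j%:R * (1 + beta / alpha) + (1 + 2 * beta / alpha)) + 1) /
     Gamma (alpha * (j%:R * (1 + beta / alpha) + (1 + 2 * beta / alpha) + 1) + 1) = q j.+1.
  rewrite (_ : alpha * _ + 1 = gam * j.+1%:R + beta + 1); last by rewrite /gam -natr1; field.
  by rewrite (_ : alpha * _ + 1 = gam * j.+2%:R + 1)//; rewrite /gam -!natr1; field.
have dK k : \prod_(0 <= j < k) (Gamma (alpha * (j%:R * (1 + beta / alpha) + (1 + 2 * beta / alpha)) + 1) /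
     Gamma (alpha * (j%:R * (1 + beta / alpha) + (1 + 2 * beta / alpha) + 1) + 1)) = d k.
  by rewrite dE big_mkord; apply: eq_bigr => j _; exact: qE.
rewrite /Kilbas_Saigo.
set S : nat -> R := fun K => _.
have SE : S = (fun K => \sum_(1 <= k < K) d k * x ^+ k).
  by apply/funext => K; apply: eq_bigr => k _; rewrite dK.
rewrite SE {S SE dK qE}.
have h : (fun K => \sum_(1 <= k < K) d k * x ^+ k) @ \oo --> psum d x - 1.
  have h2 : pseries d x K - 1 @[K --> \oo] --> psum d x - 1.
    by apply: cvgB; [exact: pseries_cvg|exact: cvg_cst].
  apply: cvg_trans h2.
  (* The leading 1 of [Kilbas_Saigo] is the term of index 0. At [K = 0] the two sequences are 0 and
     -1, so they agree only from [K = 1] on. *)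
  apply: near_eq_cvg; near=> K.
  have K0 : (0 < K)%N by near: K; exact: nbhs_infty_gt.
  by rewrite /pseries /series /= (big_ltn K0) expr0 mulr1 dE big_ord0 addrAC subrr add0r.
by rewrite (cvg_lim _ h)// addrC subrK.
Unshelve. all: by end_near. Qed.

(** With z = sqrt(lam) l^gam, [psum_d] gives 1 - F(- z) = z eta2 psum d (- z), and z / lam = l^gam /
    sqrt(lam). *)
Lemma sigma_psum l lam : 0 < l -> 0 < lam ->
  sigma alpha beta l lam = (1 - psum c (- (Num.sqrt lam * l `^ gam))) / lam.
Proof.
move=> l0 lam0; rewrite /sigma Kilbas_SaigoE psum_d.
have -> : eta2 alpha beta = q 0.
  by rewrite /eta2 /q /gam !mulr0 add0r mulr1 (addrC beta) (addrC _ 1) addrA.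
rewrite -/gam; set L := l `^ gam; set P := psum d _; move: (q 0) => Q.
have s0 : Num.sqrt lam != 0 by rewrite gt_eqF// sqrtr_gt0.
have -> : lam^-1 = (Num.sqrt lam * Num.sqrt lam)^-1 by rewrite -expr2 sqr_sqrtr// ltW.
by field.
Qed.

(** The upper bound is F(- z) >= 0. For the lower one, [lam >= lam0] keeps z away from zero, so
    [decr_at_neg_lt] separates F(- z) from 1 by one and the same [k]. *)
Lemma sigma_bounds l lam0 : 0 < l -> 0 < lam0 ->
  exists2 k : R, 0 < k & forall lam, lam0 <= lam ->
    k / lam <= sigma alpha beta l lam <= lam^-1.
Proof.
move=> l0 lam00.
have c1 : 0 < c 1%N by rewrite /c big_ord_recl big_ord0 mulr1.
have z0 : 0 < Num.sqrt lam0 * l `^ gam by rewrite mulr_gt0 ?sqrtr_gt0 ?powR_gt0.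
have [k k0 hk] := decr_at_neg_lt decr_c c1 z0.
exists k => // lam lam0l.
have lam_gt0 : 0 < lam by exact: lt_le_trans lam0l.
rewrite sigma_psum//; set z := Num.sqrt lam * l `^ gam.
have zz : Num.sqrt lam0 * l `^ gam <= z.
  by rewrite ler_wpM2r ?powR_ge0// ler_wsqrtr.
have h1 := hk z zz.
have h2 : 0 <= psum c (- z) by have [_ + _] := decr_c; apply; apply: le_trans zz; exact: ltW.
have c0 : c 0 = 1 by rewrite /c big_ord0.
by rewrite ler_pM2r ?invr_gt0// ler_pdivrMr// mulVf ?gt_eqF// c0 in h1 *; apply/andP; split; lra.
Qed.
End Kilbas_Saigo_bounds.

(** * Orthonormal expansions *)

Lemma cvg0_sqr (R : realType) (u : nat -> R) :
  u @ \oo --> (0 : R) -> u n ^+ 2 @[n --> \oo] --> (0 : R).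
Proof.
move=> u0; have := cvg_comp _ _ u0 (@exprn_continuous R 2 0).
by rewrite expr0n.
Qed.

Section L2_theory.
Context {R : realType} {N : nat}.
Variable Omega : set 'rV[R]_N.
Hypothesis openOmega : open Omega.
Implicit Types (f g h : 'rV[R]_N -> R) (c : R).
Local Notation mu := (@lebesgue_rV R N).
Local Notation "''[' f , g ]" := (L2_inner Omega f g)
  (at level 0, format "''[' f ,  g ]").

Lemma measurable_open_rV : measurable Omega.
Proof. exact: sub_sigma_algebra. Qed.

Let mO := measurable_open_rV.

Lemma integrable_L2_mul f g : L2 Omega f -> L2 Omega g ->
  mu.-integrable Omega (EFin \o (fun x => f x * g x)).
Proof.
have isq h : L2 Omega h -> mu.-integrable Omega (EFin \o (fun x => h x ^+ 2)).
  move=> [mh ih]; apply/integrableP; split.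
    by apply/measurable_EFinP; exact: measurable_funX.
  by under eq_integral do rewrite /= ger0_norm ?sqr_ge0//.
move=> Lf Lg; have [mf _] := Lf; have [mg _] := Lg.
have := integrableD mO (isq _ Lf) (isq _ Lg).
apply: le_integrable => //.
  by apply/measurable_EFinP; exact: measurable_funM.
move=> x _; rewrite /= lee_fin [leRHS]ger0_norm ?addr_ge0 ?sqr_ge0//.
by rewrite ler_norml; apply/andP; split; nra.
Qed.

Lemma L2_lin f g c : L2 Omega f -> L2 Omega g -> L2 Omega (fun x => f x + c * g x).
Proof.
move=> Lf Lg; have [mf _] := Lf; have [mg _] := Lg; split.
  apply: measurable_funD => //; apply: measurable_funM => //; exact: measurable_cst.
have i1 := integrable_L2_mul Lf Lf; have i2 := integrable_L2_mul Lf Lg.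
have i3 := integrable_L2_mul Lg Lg.
have := integrableD mO (integrableD mO i1 (integrable_EFinZl (2 * c) mO i2))
  (integrable_EFinZl (c ^+ 2) mO i3).
move=> /(integrable_lty mO) i4; apply: le_lt_trans i4.
rewrite le_eqVlt; apply/orP; left; apply/eqP.
by apply: eq_integral => x _ /=; rewrite -!EFinD; congr EFin; ring.
Qed.

Lemma L2_innerC f g : '[f, g] = '[g, f].
Proof. by apply: eq_Rintegral => x _; rewrite mulrC. Qed.

Lemma L2_inner_lin f g h c : L2 Omega f -> L2 Omega g -> L2 Omega h ->
  '[(fun x => f x + c * g x), h] = '[f, h] + c * '[g, h].
Proof.
move=> Lf Lg Lh; rewrite /L2_inner.
have i1 := integrable_L2_mul Lf Lh; have i2 := integrable_L2_mul Lg Lh.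
rewrite -RintegralZl// -RintegralD//; last exact: integrable_EFinZl.
by apply: eq_Rintegral => x _; ring.
Qed.

Lemma L2_inner_ge0 f : 0 <= '[f, f].
Proof. by apply: Rintegral_ge0 => x _; rewrite -expr2 sqr_ge0. Qed.

Lemma L2_normE f : L2_norm Omega f ^+ 2 = '[f, f].
Proof. by rewrite sqr_sqrtr// L2_inner_ge0. Qed.

Lemma L2_B f g : L2 Omega f -> L2 Omega g -> L2 Omega (f \- g).
Proof.
move=> Lf Lg; rewrite (_ : f \- g = fun x => f x + -1 * g x); first exact: L2_lin.
by apply/funext => x; rewrite mulN1r.
Qed.

Lemma L2_innerB f g h : L2 Omega f -> L2 Omega g -> L2 Omega h ->
  '[f \- g, h] = '[f, h] - '[g, h].
Proof.
move=> Lf Lg Lh; rewrite (_ : f \- g = fun x => f x + -1 * g x).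
  by rewrite L2_inner_lin// mulN1r.
by apply/funext => x; rewrite mulN1r.
Qed.

Section basis.
Variable phi : nat -> 'rV[R]_N -> R.
Hypothesis ophi : orthonormal_basis Omega phi.
Let coef f k := '[f, phi k].

Let psum (a : nat -> R) n : 'rV[R]_N -> R := fun x => \sum_(0 <= k < n) a k * phi k x.

Let psumS a n : psum a n.+1 = fun x => psum a n x + a n * phi n x.
Proof. by apply/funext => x; rewrite /psum big_nat_recr. Qed.

Let L2_0 : L2 Omega (fun=> 0).
Proof.
split; first exact: measurable_cst.
by under eq_integral do rewrite expr0n/=; rewrite integral0 ltry.
Qed.

Let L2_psum a n : L2 Omega (psum a n).
Proof.
elim: n => [|n IH].
  by rewrite (_ : psum a 0 = fun=> 0)//; apply/funext => x; rewrite /psum big_geq.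
by rewrite psumS; apply: L2_lin => //; have [] := ophi.
Qed.

Let L2_inner_psum a n h : L2 Omega h ->
  '[psum a n, h] = \sum_(0 <= k < n) a k * '[phi k, h].
Proof.
move=> Lh; have [Lphi _ _] := ophi; elim: n => [|n IH].
  rewrite big_geq// (_ : psum a 0 = fun=> 0); last by apply/funext => x; rewrite /psum big_geq.
  by rewrite /L2_inner; under eq_Rintegral do rewrite mul0r; rewrite /Rintegral integral0.
by rewrite psumS L2_inner_lin// IH big_nat_recr.
Qed.

(** Completing the square around the Fourier coefficients. The choice [a = coef f] gives Parseval
    and Bessel; a general [a] identifies the coefficients of an L2 sum. *)
Let L2_norm_psumB a f n : L2 Omega f ->
  L2_norm Omega (fun x => psum a n x - f x) ^+ 2 =
  '[f, f] - \sum_(0 <= k < n) coef f k ^+ 2 + \sum_(0 <= k < n) (a k - coef f k) ^+ 2.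
Proof.
move=> Lf; have [Lphi oo _] := ophi; rewrite L2_normE.
have LB := L2_B (L2_psum a n) Lf.
rewrite [LHS](L2_innerB (L2_psum a n) Lf LB) (L2_innerC _ (psum a n \- f)) (L2_innerC f).
rewrite !(L2_innerB (L2_psum a n) Lf)// (L2_innerC f) !L2_inner_psum//.
have -> : \sum_(0 <= k < n) a k * '[phi k, psum a n] = \sum_(0 <= k < n) a k ^+ 2.
  apply: eq_big_nat => k /andP[_ kn]; rewrite L2_innerC L2_inner_psum//.
  rewrite big_mkord (bigD1 (Ordinal kn))//= oo eqxx mulr1 big1 ?addr0 -?expr2//.
  by move=> j /eqP jk; rewrite oo; case: eqP => [e|_]; [case: jk; exact: val_inj|rewrite mulr0].
have -> : \sum_(0 <= k < n) (a k - coef f k) ^+ 2 = \sum_(0 <= k < n) a k ^+ 2 -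
    2 * (\sum_(0 <= k < n) a k * '[phi k, f]) + \sum_(0 <= k < n) coef f k ^+ 2.
  rewrite mulr_sumr -sumrB -big_split/=; apply: eq_bigr => k _.
  by rewrite /coef (L2_innerC f); ring.
by ring.
Qed.

Lemma parseval f : L2 Omega f ->
  \sum_(0 <= k < n) coef f k ^+ 2 @[n --> \oo] --> L2_norm Omega f ^+ 2.
Proof.
move=> Lf; have [_ _ /(_ f Lf) [_ h]] := ophi.
have h2 : L2_norm Omega (fun x => psum (coef f) n x - f x) ^+ 2 @[n --> \oo] --> (0 : R).
  exact: cvg0_sqr.
rewrite L2_normE -[X in _ --> X]subr0.
rewrite (_ : (fun n => \sum_(0 <= k < n) coef f k ^+ 2) =
  (fun n => '[f, f] - L2_norm Omega (fun x => psum (coef f) n x - f x) ^+ 2)).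
  by apply: cvgB => //; exact: cvg_cst.
apply/funext => n; rewrite L2_norm_psumB//.
by rewrite [X in _ - (_ + X)]big1 ?addr0 ?subKr// => k _; rewrite subrr expr0n.
Qed.

Lemma bessel f n : L2 Omega f ->
  \sum_(0 <= k < n) coef f k ^+ 2 <= L2_norm Omega f ^+ 2.
Proof.
move=> Lf; have := L2_norm_psumB (coef f) n Lf; rewrite [X in _ + X]big1.
  by rewrite addr0 -L2_normE => h; rewrite -subr_ge0 -h sqr_ge0.
by move=> k _; rewrite subrr expr0n.
Qed.

(** For [n > k], the square of [a k - coef f k] is one of the nonnegative contributions to the
    squared error of the partial sum, which tends to zero. *)
Lemma L2_sum_coef a f k : L2_sum Omega a phi f -> coef f k = a k.
Proof.
move=> [Lf h].
have h2 : L2_norm Omega (fun x => psum a n x - f x) ^+ 2 @[n --> \oo] --> (0 : R).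
  exact: cvg0_sqr.
apply/esym/eqP; rewrite -subr_eq0 -sqrf_eq0 eq_le sqr_ge0 andbT.
apply: (ler_cvg_to (cvg_cst _) h2); near=> n.
have kn : (k < n)%N by near: n; exact: nbhs_infty_gt.
rewrite L2_norm_psumB// ler_wpDl//; first by rewrite subr_ge0 -L2_normE bessel.
rewrite big_mkord (bigD1 (Ordinal kn))//= lerDl sumr_ge0// => i _.
exact: sqr_ge0.
Unshelve. all: by end_near. Qed.
End basis.
End L2_theory.

(** * Estimates for the regularized sequence *)

(** With x^q = (x^r)^(q / r) this is [powR_1D_le_expR]. It lets the exponential weight absorb every
    negative power of the symbol, so that [p] can be arbitrary. *)
Lemma powR_le_expR_powR (R : realType) (r q : R) : 0 < r -> 0 <= q ->
  exists2 C : R, 0 < C & forall x : R, 0 <= x -> x `^ q <= C * expR (x `^ r).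
Proof.
move=> r0 q0; have qr0 : 0 <= q / r by rewrite divr_ge0// ltW.
have [C C0 hC] := powR_1D_le_expR qr0 (@ltr01 R).
exists C => // x x0.
have -> : x `^ q = (x `^ r) `^ (q / r).
  by rewrite -powRrM mulrCA divff ?mulr1// gt_eqF.
have := hC _ (powR_ge0 x r); rewrite mul1r; apply: le_trans.
by apply: ge0_ler_powR; rewrite ?nnegrE ?addr_ge0 ?powR_ge0// lerDr.
Qed.

Lemma invr_powR (R : realType) (x t : R) : 0 < x -> x^-1 `^ t = x `^ (- t).
Proof. by move=> x0; rewrite -(powR_inv1 (ltW x0)) -powRrM mulN1r. Qed.

(** Termwise splitting at a threshold [s]: one of [sig k / s] and [s / sig k] is at least one, so
    (sig_k / s)^2 + (s / sig_k)^p >= 1. The value of [s] makes the two resulting sums equal, whence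
    the factor 2. *)
Lemma sum_sqr_interpolation (R : realType) (p A B : R) (sig b : nat -> R) n :
  0 < p -> 0 < A -> 0 < B -> (forall k, 0 < sig k) ->
  \sum_(0 <= k < n) (sig k * b k) ^+ 2 <= A ->
  \sum_(0 <= k < n) sig k `^ (- p) * b k ^+ 2 <= B ->
  \sum_(0 <= k < n) b k ^+ 2 <= 2 * (A `^ (p / (p + 2)) * B `^ (2 / (p + 2))).
Proof.
move=> p0 A0 B0 s0 hA hB.
have p2 : 0 < p + 2 by lra.
have p2_neq0 : p + 2 != 0 by rewrite gt_eqF.
pose s := (A / B) `^ (p + 2)^-1.
have AB0 : 0 < A / B by rewrite divr_gt0.
have sp : 0 < s by rewrite powR_gt0.
have pw k : b k ^+ 2 <= (s ^+ 2)^-1 * (sig k * b k) ^+ 2 +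
    s `^ p * (sig k `^ (- p) * b k ^+ 2).
  have e : (s ^+ 2)^-1 * (sig k * b k) ^+ 2 + s `^ p * (sig k `^ (- p) * b k ^+ 2) =
     ((sig k / s) ^+ 2 + (s / sig k) `^ p) * b k ^+ 2.
    rewrite powRM ?invr_ge0 ?(ltW sp) ?(ltW (s0 _))// invr_powR// mulrDl mulrA; congr (_ + _).
    by rewrite !exprMn exprVn; ring.
  rewrite e -[leLHS]mul1r ler_wpM2r ?sqr_ge0//.
  have [ss|ss] := leP s (sig k).
    apply: ler_wpDr; first exact: powR_ge0.
    by apply: exprn_ege1; rewrite ler_pdivlMr// mul1r.
  apply: ler_wpDl; first exact: sqr_ge0.
  rewrite -(powRr0 (s / sig k)); apply: ler_powR; last exact: ltW.
  by rewrite ler_pdivlMr// mul1r ltW.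
apply: (@le_trans _ _ ((s ^+ 2)^-1 * A + s `^ p * B)).
  apply: (@le_trans _ _ (\sum_(0 <= k < n) ((s ^+ 2)^-1 * (sig k * b k) ^+ 2 +
    s `^ p * (sig k `^ (- p) * b k ^+ 2)))); first by apply: ler_sum => k _; exact: pw.
  rewrite big_split/= -!mulr_sumr lerD// ler_wpM2l ?powR_ge0//.
  by rewrite invr_ge0 sqr_ge0.
have dAB t : (A / B) `^ t = A `^ t * B `^ (- t).
  by rewrite powRM ?invr_ge0 ?(ltW A0) ?(ltW B0)// invr_powR.
have ABD x t u : 0 < x -> x `^ t * x `^ u = x `^ (t + u).
  by move=> x0; rewrite powRD// (gt_eqF x0) implybT.
have e1 : (s ^+ 2)^-1 * A = A `^ (p / (p + 2)) * B `^ (2 / (p + 2)).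
  rewrite -powR_mulrn ?(ltW sp)// -powRN -powRrM dAB mulrAC -{2}(powRr1 (ltW A0)).
  by rewrite ABD//; congr (A `^ _ * B `^ _); field.
have e2 : s `^ p * B = A `^ (p / (p + 2)) * B `^ (2 / (p + 2)).
  rewrite -powRrM dAB -mulrA -{2}(powRr1 (ltW B0)).
  by rewrite ABD//; congr (A `^ _ * B `^ _); field.
by rewrite e1 e2; lra.
Qed.

(* [(x + y)^2 <= (1 + e) x^2 + (1 + e^-1) y^2] for [e = (rho^2 - 1) / 2]
   absorbs the noise into the discrepancy [rho * delta] for every [rho > 1]. *)
Lemma discrepancy_tau_ge (R : realType) (rho S : R) : 1 < rho -> 0 < S ->
  exists2 kappa : R, 0 < kappa &
  forall (delta E tau : R) (sig e d a : nat -> R), 0 < tau ->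
    (forall k, 0 < sig k <= S) -> (forall k, 0 < e k) ->
    (forall n, \sum_(0 <= k < n) (d k - sig k * a k) ^+ 2 <= delta ^+ 2) ->
    (forall n, \sum_(0 <= k < n) e k * a k ^+ 2 <= E ^+ 2) ->
    \sum_(0 <= k < n) (sig k * (d k / (sig k + tau * e k)) - d k) ^+ 2 @[n --> \oo] -->
      (rho * delta) ^+ 2 ->
    kappa * delta ^+ 2 <= tau * E ^+ 2.
Proof.
move=> rho1 S0.
have r21 : 1 < rho ^+ 2 by rewrite exprn_egt1.
pose ep := (rho ^+ 2 - 1) / 2.
have ep0 : 0 < ep by rewrite /ep; lra.
have epV0 : 0 < ep^-1 by rewrite invr_gt0.
have K0 : 0 < (1 + ep^-1) * S by rewrite mulr_gt0//; lra.
(* Since [rho ^+ 2 = 1 + 2 * ep], moving the noise [(1 + ep) * delta ^+ 2] to the left leaves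
   [ep * delta ^+ 2], bounded by [(1 + ep^-1) * S * tau * E ^+ 2]. *)
exists (ep / ((1 + ep^-1) * S)); first by rewrite divr_gt0.
move=> delta E tau sig e d a tau0 hsig he hd ha hlim.
have pw k : (sig k * (d k / (sig k + tau * e k)) - d k) ^+ 2 <=
    (1 + ep) * (d k - sig k * a k) ^+ 2 + (1 + ep^-1) * S * tau * (e k * a k ^+ 2).
  have /andP[s0 sS] := hsig k.
  have x0 : 0 < tau * e k by rewrite mulr_gt0.
  have sx : 0 < sig k + tau * e k by lra.
  pose u := tau * e k / (sig k + tau * e k).
  have u0 : 0 <= u by rewrite divr_ge0 ?ltW.
  have u1 : u <= 1 by rewrite ler_pdivrMr// mul1r; lra.
  have -> : sig k * (d k / (sig k + tau * e k)) - d k =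
      - (u * (d k - sig k * a k) + u * sig k * a k).
    by rewrite /u; field; rewrite gt_eqF.
  rewrite sqrrN.
  have young (x y : R) : (x + y) ^+ 2 <= (1 + ep) * x ^+ 2 + (1 + ep^-1) * y ^+ 2.
    rewrite -subr_ge0; have -> : (1 + ep) * x ^+ 2 + (1 + ep^-1) * y ^+ 2 - (x + y) ^+ 2 =
      ep^-1 * (ep * x - y) ^+ 2 by field; rewrite gt_eqF.
    by rewrite mulr_ge0 ?sqr_ge0// ltW.
  apply: le_trans (young _ _) _; apply: lerD.
    rewrite ler_wpM2l; [by []|lra|].
    rewrite exprMn -[leRHS]mul1r ler_wpM2r ?sqr_ge0//.
    by rewrite exprn_ile1.
  (* The product [u * sig k] is bounded both by [tau * e k] and by [S]. Multiplying the two bounds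
     makes its square linear in [tau * e k], which produces the weight of the exponential norm. *)
  have us : u * sig k <= tau * e k.
    rewrite /u mulrAC ler_pdivrMr// ler_wpM2l ?ltW//; lra.
  have us2 : u * sig k <= S.
    by apply: le_trans sS; rewrite -[leRHS]mul1r ler_wpM2r// ltW.
  have us0 : 0 <= u * sig k by rewrite mulr_ge0// ltW.
  have -> : (1 + ep^-1) * S * tau * (e k * a k ^+ 2) =
      (1 + ep^-1) * (S * (tau * e k) * a k ^+ 2) by ring.
  rewrite ler_wpM2l; [by []|lra|].
  by rewrite exprMn ler_wpM2r ?sqr_ge0// expr2 ler_pM.
have bd : (rho * delta) ^+ 2 <= (1 + ep) * delta ^+ 2 + (1 + ep^-1) * S * tau * E ^+ 2.
  apply: (ler_cvg_to hlim (cvg_cst _)); apply: nearW => n.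
  apply: (@le_trans _ _ (\sum_(0 <= k < n) ((1 + ep) * (d k - sig k * a k) ^+ 2 +
    (1 + ep^-1) * S * tau * (e k * a k ^+ 2)))).
    by apply: ler_sum => k _; exact: pw.
  rewrite big_split/= -!mulr_sumr lerD// ler_wpM2l//; [lra|].
  by rewrite mulr_ge0 ?ltW.
rewrite mulrAC ler_pdivrMr//.
rewrite exprMn in bd.
have e1 : rho ^+ 2 = 1 + 2 * ep by rewrite /ep; field.
rewrite e1 in bd.
rewrite [leRHS]mulrC mulrA.
by move: bd; rewrite !mulrDl mul1r; lra.
Qed.

Lemma powR_sqr (R : realType) (x t : R) : 0 <= x -> (x ^+ 2) `^ t = (x `^ t) ^+ 2.
Proof. by move=> x0; rewrite expr2 powRM// -expr2. Qed.

Lemma sqrB_le (R : realFieldType) (x y : R) : (x - y) ^+ 2 <= 2 * x ^+ 2 + 2 * y ^+ 2.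
Proof.
rewrite -subr_ge0 (_ : _ - _ = (x + y) ^+ 2); [exact: sqr_ge0|ring].
Qed.

(** Here [a], [d] and [e] stand for the coefficients of the source, those of the noisy data and the
    exponential weights. The power [- p] of [sig] serves the interpolation of the bias, the power
    [- (p + 1)] the propagated noise. *)
Lemma regularized_sum_le (R : realType) (p rho S B : R) :
  0 < p -> 1 < rho -> 0 < S -> 0 < B ->
  exists2 C : R, 0 < C &
  forall (delta E tau : R) (sig e d a : nat -> R),
    0 < delta -> 0 < E -> 0 < tau ->
    (forall k, 0 < sig k <= S) -> (forall k, 0 < e k) ->
    (forall k, sig k `^ (- p) <= B * e k) ->
    (forall k, sig k `^ (- (p + 1)) <= B * e k) ->
    (forall n, \sum_(0 <= k < n) (d k - sig k * a k) ^+ 2 <= delta ^+ 2) ->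
    (forall n, \sum_(0 <= k < n) e k * a k ^+ 2 <= E ^+ 2) ->
    (forall n, \sum_(0 <= k < n) (sig k * (d k / (sig k + tau * e k)) - d k) ^+ 2 <=
      (rho * delta) ^+ 2) ->
    \sum_(0 <= k < n) (sig k * (d k / (sig k + tau * e k)) - d k) ^+ 2 @[n --> \oo] -->
      (rho * delta) ^+ 2 ->
    forall n, \sum_(0 <= k < n) (d k / (sig k + tau * e k) - a k) ^+ 2 <=
      (C * ((1 + rho) `^ (p / (p + 2)) * (E `^ (2 / (p + 2)) * delta `^ (p / (p + 2))))) ^+ 2.
Proof.
move=> p0 rho1 S0 B0.
have [kappa k0 hkappa] := discrepancy_tau_ge rho1 S0.
have p20 : 0 < p + 2 by lra.
have p2_neq0 : p + 2 != 0 by rewrite gt_eqF.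
set th := p / (p + 2); set w := 2 / (p + 2).
have w0 : 0 <= w by rewrite divr_ge0 ?ltW.
have th0 : 0 <= th by rewrite divr_ge0 ?ltW.
have wth : th = 1 - w by rewrite /th /w; field.
(* The first summand comes from the noise, the second from the bias; its factor 4 combines [sqrB_le]
   with the 2 of the interpolation. *)
pose C2 := 2 * (B / kappa) `^ w + 4 * (2 `^ th * B `^ w).
have C20 : 0 < C2.
  by rewrite ltr_wpDr// ?mulr_ge0 ?powR_ge0// mulr_gt0// powR_gt0// divr_gt0.
exists (Num.sqrt C2); first by rewrite sqrtr_gt0.
move=> delta E tau sig e d a delta0 E0 tau0 hsig he hp hp1 hd ha hm hlim n.
have htau := hkappa delta E tau sig e d a tau0 hsig he hd ha hlim.
have s0 k : 0 < sig k by have /andP[] := hsig k.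
have te k : 0 < tau * e k by rewrite mulr_gt0.
pose X k := sig k + tau * e k.
have X0 k : 0 < X k by rewrite addr_gt0.
pose b k := tau * e k / X k * a k.
have pw k : (d k / X k - a k) ^+ 2 <=
    2 * ((X k ^+ 2)^-1 * (d k - sig k * a k) ^+ 2) + 2 * b k ^+ 2.
  have -> : d k / X k - a k = (d k - sig k * a k) / X k - b k.
    by rewrite /b /X; field; rewrite gt_eqF// X0.
  by rewrite -exprVn -exprMn (mulrC (X k)^-1); exact: sqrB_le.
(* One factor (X_k)^(-1) is bounded by (tau e_k)^(-1), the others by B e_k, so that e_k cancels. The
   power [w = 2 / (p + 2)] then brings the exponent back to -2. *)
have noise k : (X k ^+ 2)^-1 <= (B / tau) `^ w.
  have X1 : X k `^ (- (p + 2)) <= B / tau.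
    have -> : - (p + 2) = - (p + 1) + -1 by ring.
    rewrite powRD ?(gt_eqF (X0 _)) ?implybT// powR_inv1 ?(ltW (X0 _))//.
    have h1 : X k `^ (- (p + 1)) <= B * e k.
      apply: le_trans (hp1 k); rewrite !powRN lef_pV2 ?posrE ?powR_gt0//.
      by apply: ge0_ler_powR => //; rewrite ?nnegrE ?(ltW (X0 _)) ?(ltW (s0 _)) ?lerDl ?(ltW (te _))//; lra.
    have h2 : (X k)^-1 <= (tau * e k)^-1.
      by rewrite lef_pV2 ?posrE// lerDr ltW.
    apply: (@le_trans _ _ (B * e k * (tau * e k)^-1)).
      by apply: ler_pM => //; rewrite ?powR_ge0 ?invr_ge0 ?(ltW (X0 _)).
    rewrite invfM mulrACA divff ?mulr1// gt_eqF//.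
  have -> : (X k ^+ 2)^-1 = (X k `^ (- (p + 2))) `^ w.
    rewrite -powRrM -powR_mulrn ?(ltW (X0 _))// -powRN; congr (_ `^ _).
    by rewrite /w; field.
  by apply: ge0_ler_powR => //; rewrite ?nnegrE ?powR_ge0 ?divr_ge0 ?(ltW B0) ?(ltW tau0)//.
(* The lower bound on [tau] from the discrepancy principle reads B / tau <= (B / kappa) (E /
   delta)^2. *)
have noise2 : (B / tau) `^ w * delta ^+ 2 <= (B / kappa) `^ w * (E `^ w * delta `^ th) ^+ 2.
  have d2 : 0 < delta ^+ 2 by rewrite exprn_gt0.
  have h1 : B / tau <= B / kappa * (E ^+ 2 / delta ^+ 2).
    rewrite -mulrA ler_wpM2l ?(ltW B0)// -[leLHS]mul1r ler_pdivrMr//.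
    have -> : kappa^-1 * (E ^+ 2 / delta ^+ 2) * tau = (tau * E ^+ 2) / (kappa * delta ^+ 2).
      by field; rewrite !gt_eqF.
    by rewrite ler_pdivlMr ?mul1r// mulr_gt0.
  have h2 : (B / tau) `^ w <= (B / kappa) `^ w * (E ^+ 2 / delta ^+ 2) `^ w.
    have E2 : 0 <= E ^+ 2 / delta ^+ 2 by rewrite divr_ge0 ?sqr_ge0.
    have Bk0 : 0 <= B / kappa by rewrite divr_ge0// ltW.
    rewrite -powRM//; apply: ge0_ler_powR => //; rewrite nnegrE.
      by rewrite divr_ge0// ltW.
    exact: mulr_ge0.
  apply: (@le_trans _ _ ((B / kappa) `^ w * (E ^+ 2 / delta ^+ 2) `^ w * delta ^+ 2)).
    by rewrite ler_wpM2r ?sqr_ge0.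
  have h3 : (E / delta) `^ w * delta = E `^ w * delta `^ th.
    rewrite powRM ?invr_ge0 ?(ltW E0) ?(ltW delta0)// -(powR_inv1 (ltW delta0)).
    rewrite -powRrM mulN1r -mulrA -[X in _ * (_ * X) = _](powRr1 (ltW delta0)).
    by rewrite -powRD ?(gt_eqF delta0) ?implybT// wth addrC.
  rewrite -mulrA ler_wpM2l ?powR_ge0// -expr_div_n.
  by rewrite powR_sqr ?divr_ge0 ?(ltW E0) ?(ltW delta0)// -exprMn h3.
have bias : \sum_(0 <= k < n) b k ^+ 2 <=
    2 * ((2 * ((1 + rho) * delta) ^+ 2) `^ th * (B * E ^+ 2) `^ w).
  apply: (sum_sqr_interpolation (sig := sig)) => //.
  - by rewrite mulr_gt0// exprn_gt0// mulr_gt0//; lra.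
  - by rewrite mulr_gt0// exprn_gt0.
  - apply: (@le_trans _ _ (2 * (rho * delta) ^+ 2 + 2 * delta ^+ 2)); last first.
      have rd : 0 < rho * delta by rewrite mulr_gt0//; lra.
      have -> : (1 + rho) * delta = delta + rho * delta by ring.
      by rewrite sqrrD; have := mulr_gt0 delta0 rd; lra.
    apply: (@le_trans _ _ (2 * \sum_(0 <= k < n) (sig k * (d k / X k) - d k) ^+ 2 +
        2 * \sum_(0 <= k < n) (d k - sig k * a k) ^+ 2)); last first.
      by apply: lerD; apply: ler_wpM2l.
    rewrite !mulr_sumr -big_split/=; apply: ler_sum => k _.
    (* The image of the bias under K is a combination of the residual, of size [rho * delta], and of
       a damped copy of the noise, of size at most [delta]. *)
    have -> : sig k * b k = - (sig k * (d k / X k) - d k) - tau * e k / X k * (d k - sig k * a k).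
      by rewrite /b /X; field; rewrite gt_eqF// X0.
    have u1 : tau * e k / X k <= 1 by rewrite ler_pdivrMr// mul1r lerDr ltW.
    have u0 : 0 <= tau * e k / X k by rewrite divr_ge0 ?ltW.
    set x := sig k * _ - _; set y := d k - _; set u := tau * e k / X k in u0 u1 *.
    have uy : (u * y) ^+ 2 <= y ^+ 2.
      by rewrite exprMn -[leRHS]mul1r ler_wpM2r ?sqr_ge0// exprn_ile1.
    apply: (@le_trans _ _ (2 * x ^+ 2 + 2 * (u * y) ^+ 2)); last by rewrite lerD2l; lra.
    by rewrite -(sqrrN x); exact: sqrB_le.
  - apply: (@le_trans _ _ (B * \sum_(0 <= k < n) e k * a k ^+ 2)); last by rewrite ler_wpM2l ?(ltW B0).
    rewrite mulr_sumr; apply: ler_sum => k _; rewrite mulrA.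
    apply: ler_pM; rewrite ?powR_ge0 ?sqr_ge0//.
    have u1 : tau * e k / X k <= 1 by rewrite ler_pdivrMr// mul1r lerDr ltW.
    have u0 : 0 <= tau * e k / X k by rewrite divr_ge0 ?ltW.
    by rewrite /b exprMn -[leRHS]mul1r ler_wpM2r ?sqr_ge0// exprn_ile1.
have r10 : 0 <= 1 + rho by lra.
(* The noise bound carries no power of [1 + rho]; this factor, at least one, is inserted there to
   match the bias. *)
have r11 : 1 <= (1 + rho) `^ th.
  by rewrite -[leLHS](powRr0 (1 + rho)); apply: ler_powR => //; lra.
have biasE : (2 * ((1 + rho) * delta) ^+ 2) `^ th * (B * E ^+ 2) `^ w =
    2 `^ th * B `^ w * ((1 + rho) `^ th * (E `^ w * delta `^ th)) ^+ 2.
  have rd : 0 <= (1 + rho) * delta by rewrite mulr_ge0// ltW.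
  rewrite powRM ?sqr_ge0// powR_sqr// (powRM _ r10 (ltW delta0)).
  by rewrite powRM ?sqr_ge0 ?(ltW B0)// powR_sqr ?(ltW E0)//; ring.
apply: (@le_trans _ _ (2 * ((B / kappa) `^ w * (E `^ w * delta `^ th) ^+ 2) +
    2 * (2 * (2 `^ th * B `^ w * ((1 + rho) `^ th * (E `^ w * delta `^ th)) ^+ 2)))).
  rewrite biasE in bias.
  apply: (@le_trans _ _ (\sum_(0 <= k < n) (2 * ((X k ^+ 2)^-1 * (d k - sig k * a k) ^+ 2) +
     2 * b k ^+ 2))); first by apply: ler_sum => k _; exact: pw.
  rewrite big_split/= -!mulr_sumr lerD// ler_wpM2l//.
  apply: le_trans noise2; apply: (@le_trans _ _ ((B / tau) `^ w *
    \sum_(0 <= k < n) (d k - sig k * a k) ^+ 2)); last by rewrite ler_wpM2l ?powR_ge0.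
  rewrite mulr_sumr; apply: ler_sum => k _; by rewrite ler_wpM2r ?sqr_ge0.
rewrite [leRHS]exprMn sqr_sqrtr ?(ltW C20)// /C2 [leRHS]mulrDl; apply: lerD; last first.
  by rewrite le_eqVlt; apply/orP; left; apply/eqP; ring.
rewrite -[leRHS]mulrA ler_wpM2l// ler_wpM2l ?powR_ge0// [leRHS]exprMn -[leLHS]mul1r.
by rewrite ler_wpM2r ?sqr_ge0// exprn_ege1.
Qed.

(** * Transfer to L2 and final estimates *)

Lemma exp_sqnorm_partial_le (R : realType) (N : nat) (Omega : set 'rV[R]_N)
    (lam : nat -> R) (phi : nat -> 'rV[R]_N -> R) (r E : R) (g : 'rV[R]_N -> R) n :
  0 <= E -> exp_dom Omega lam phi r g -> exp_norm Omega lam phi r g <= E ->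
  \sum_(0 <= k < n) expR (lam k `^ r) * L2_inner Omega g (phi k) ^+ 2 <= E ^+ 2.
Proof.
move=> E0 [_]; rewrite /exp_norm; set S := exp_sqnorm _ _ _ _ _ => Soo SE.
pose u k := (expR (lam k `^ r) * `|L2_inner Omega g (phi k)| ^+ 2)%:E.
have u0 k : (0 <= u k)%E by rewrite lee_fin mulr_ge0 ?expR_ge0 ?sqr_ge0.
have S0 : (0 <= S)%E by apply: nneseries_ge0.
(* [fine] sends [+oo] to 0, so the bound on [exp_norm] has content only together with the finiteness
   contained in [exp_dom]. *)
have Sfin : S = (fine S)%:E by rewrite fineK// ge0_fin_numE.
have fS0 : 0 <= fine S by exact: fine_ge0.
apply: (@le_trans _ _ (fine S)); last first.
  by rewrite -(sqr_sqrtr fS0) lerXn2r// nnegrE sqrtr_ge0.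
rewrite -lee_fin -Sfin -sumEFin.
have := @nneseries_lim_ge R u xpredT 0 n (fun k _ _ => u0 k).
apply: le_trans; rewrite le_eqVlt; apply/orP; left; apply/eqP.
by apply: eq_bigr => k _; rewrite /u real_normK ?num_real.
Qed.

(** Reduction to coefficients: Bessel turns the bounds on the noise and on the residual into bounds
    on partial sums, and Parseval turns the result back into a norm. *)
Lemma regularized_L2_norm_le (R : realType) (N : nat) (alpha beta l rho : R)
  (Omega : set 'rV[R]_N) (lam : nat -> R) (phi : nat -> 'rV[R]_N -> R) (r p : R) :
  0 < alpha <= 1 -> 0 <= beta -> 0 < l -> 1 < rho -> open Omega ->
  orthonormal_basis Omega phi -> 0 < lam 0%N ->
  {homo lam : j k / (j <= k)%N >-> j <= k} -> 0 < r -> 0 < p ->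
  exists2 C : R, 0 < C &
    forall (E delta tau : R) (g h hd gt Kgt : 'rV[R]_N -> R),
      0 < E -> exp_dom Omega lam phi r g ->
      exp_norm Omega lam phi r g <= E ->
      is_K alpha beta l Omega lam phi g h ->
      L2 Omega hd -> 0 < delta ->
      L2_norm Omega (hd \- h) <= delta ->
      0 < tau -> is_regularized alpha beta l Omega lam phi r tau hd gt ->
      is_K alpha beta l Omega lam phi gt Kgt ->
      L2_norm Omega (Kgt \- hd) = rho * delta ->
      L2_norm Omega (gt \- g) <= C * ((1 + rho) `^ (p / (p + 2)) *
        (E `^ (2 / (p + 2)) * delta `^ (p / (p + 2)))).
Proof.
move=> halpha hbeta hl hrho oO ophi lam0 lam_homo r0 p0.
have [kappa k0 hk] := sigma_bounds halpha hbeta hl lam0.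
have lam_ge k : lam 0%N <= lam k by exact: lam_homo.
have lam_gt0 k : 0 < lam k by exact: lt_le_trans (lam_ge k).
pose sig k := sigma alpha beta l (lam k).
pose e k := expR (lam k `^ r).
have sigl k : kappa / lam k <= sig k by have /andP[] := hk _ (lam_ge k).
have sig0 k : 0 < sig k by apply: lt_le_trans (sigl k); rewrite divr_gt0.
pose S := (lam 0%N)^-1.
have S0 : 0 < S by rewrite invr_gt0.
have hsig k : 0 < sig k <= S.
  rewrite sig0/=; have /andP[_ h] := hk _ (lam_ge k).
  by apply: le_trans h _; rewrite lef_pV2 ?posrE.
have e0 k : 0 < e k by exact: expR_gt0.
(* From [sig k >= kappa / lam k], the negative power is at most a multiple of [lam k] to the power
   [q], which the exponential weight dominates. *)
have sigpow q : 0 < q -> exists2 B : R, 0 < B & forall k, sig k `^ (- q) <= B * e k.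
  move=> q0; have [C C0 hC] := powR_le_expR_powR r0 (ltW q0).
  exists ((kappa `^ q)^-1 * C); first by rewrite mulr_gt0 ?invr_gt0 ?powR_gt0.
  move=> k; rewrite -mulrA.
  apply: (@le_trans _ _ ((kappa `^ q)^-1 * lam k `^ q)); last first.
    by apply: ler_wpM2l; [rewrite invr_ge0 powR_ge0|exact/hC/ltW].
  rewrite powRN -[leRHS]invrK lef_pV2 ?posrE ?invr_gt0 ?mulr_gt0 ?invr_gt0 ?powR_gt0//.
  rewrite invfM invrK.
  have -> : kappa `^ q / lam k `^ q = (kappa / lam k) `^ q.
    by rewrite powRM ?invr_ge0 ?(ltW k0) ?(ltW (lam_gt0 _))// invr_powR// powRN.
  apply: ge0_ler_powR; rewrite ?nnegrE ?divr_ge0 ?(ltW k0) ?(ltW (lam_gt0 _)) ?(ltW (sig0 _)) ?(ltW q0)//.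
have [B1 B10 hB1] := sigpow p p0.
have p10 : 0 < p + 1 by lra.
have [B2 B20 hB2] := sigpow (p + 1) p10.
have B0 : 0 < B1 + B2 by rewrite addr_gt0.
have [C C0 hC] := regularized_sum_le p0 hrho S0 B0.
exists C => // E delta tau g h hd gt Kgt E0 Dg gE Kg Lhd delta0 hdh tau0 Rgt Kgt_ KgtE.
have Lg : L2 Omega g by case: Dg.
have Lh : L2 Omega h by case: Kg.
have Lgt : L2 Omega gt by case: Rgt.
have LKgt : L2 Omega Kgt by case: Kgt_.
have [Lphi _ _] := ophi.
pose a k := L2_inner Omega g (phi k).
pose d k := L2_inner Omega hd (phi k).
have coefh k : L2_inner Omega h (phi k) = sig k * a k.
  by rewrite (L2_sum_coef oO ophi k Kg).
have coefgt k : L2_inner Omega gt (phi k) = d k / (sig k + tau * e k).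
  by rewrite (L2_sum_coef oO ophi k Rgt) mulrC.
have coefKgt k : L2_inner Omega Kgt (phi k) = sig k * (d k / (sig k + tau * e k)).
  by rewrite (L2_sum_coef oO ophi k Kgt_) coefgt.
have noise n : \sum_(0 <= k < n) (d k - sig k * a k) ^+ 2 <= delta ^+ 2.
  have := bessel oO ophi n (L2_B oO Lhd Lh).
  under eq_bigr do rewrite (L2_innerB oO Lhd Lh (Lphi _)) coefh.
  move=> hb; apply: le_trans hb _.
  by rewrite lerXn2r// nnegrE ?sqrtr_ge0 ?(ltW delta0).
have Ksum : (fun n => \sum_(0 <= k < n) L2_inner Omega (Kgt \- hd) (phi k) ^+ 2) =
    (fun n => \sum_(0 <= k < n) (sig k * (d k / (sig k + tau * e k)) - d k) ^+ 2).
  by apply/funext => n; apply: eq_bigr => k _; rewrite (L2_innerB oO LKgt Lhd (Lphi _)) coefKgt.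
have Klim := parseval oO ophi (L2_B oO LKgt Lhd); rewrite Ksum KgtE in Klim.
have Kle n : \sum_(0 <= k < n) (sig k * (d k / (sig k + tau * e k)) - d k) ^+ 2 <=
    (rho * delta) ^+ 2.
  have := bessel oO ophi n (L2_B oO LKgt Lhd); rewrite KgtE; apply: le_trans.
  by rewrite -[leRHS]/((fun n => \sum_(0 <= k < n) L2_inner Omega (Kgt \- hd) (phi k) ^+ 2) n) Ksum.
have final n : \sum_(0 <= k < n) (d k / (sig k + tau * e k) - a k) ^+ 2 <=
    (C * ((1 + rho) `^ (p / (p + 2)) * (E `^ (2 / (p + 2)) * delta `^ (p / (p + 2))))) ^+ 2.
  apply: (hC delta E tau sig e d a) => //.
  - by move=> k; apply: le_trans (hB1 k) _; rewrite ler_wpM2r ?(ltW (e0 _))// lerDl ltW.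
  - by move=> k; apply: le_trans (hB2 k) _; rewrite ler_wpM2r ?(ltW (e0 _))// lerDr ltW.
  - by move=> m; apply: exp_sqnorm_partial_le => //; exact: ltW.
set X := C * _ in final *.
have X0 : 0 <= X by rewrite mulr_ge0 ?(ltW C0)// mulr_ge0 ?powR_ge0// mulr_ge0 ?powR_ge0.
rewrite -(@ler_pXn2r _ 2)// ?nnegrE ?sqrtr_ge0//.
apply: (ler_cvg_to (parseval oO ophi (L2_B oO Lgt Lg)) (cvg_cst _)); apply: nearW => n.
apply: le_trans (final n); rewrite le_eqVlt; apply/orP; left; apply/eqP.
by apply: eq_bigr => k _; rewrite (L2_innerB oO Lgt Lg (Lphi _)) coefgt.
Qed.

(** The logarithmic factor is at most C x^(- 1 / (p + 2)), because |ln x| = - ln x for x < 1. The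
    remaining power is x^((p + 1) / (p + 2)), which exceeds the target exponent by 1 / (p + 2). *)
Lemma littleo_mul_powR_ln (R : realType) (r p : R) : 0 < r -> 0 < p ->
  (fun delta : R => delta * (1 + `|ln delta|) `^ r^-1 : R^o)
    =o_ ((0 : R)^'+) (fun delta : R => delta `^ (p / (p + 2)) : R^o).
Proof.
move=> r0 p0.
have p20 : 0 < p + 2 by lra.
have v0 : 0 < (p + 2)^-1 by rewrite invr_gt0.
have rV0 : 0 <= r^-1 by rewrite invr_ge0 ltW.
have [C C0 hC] := powR_1D_le_expR rV0 v0.
apply/eqoP => ep ep0; near=> x.
have x0 : 0 < x by near: x; exact: nbhs_right_gt.
have x1 : x < 1 by near: x; exact: nbhs_right_lt.
have lx : ln x < 0 by apply: ln_lt0; rewrite x0 x1.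
rewrite ger0_norm ?mulr_ge0 ?powR_ge0 ?(ltW x0)// [in leRHS]ger0_norm ?powR_ge0//.
have := hC _ (normr_ge0 (ln x)); rewrite [in X in _ <= X](ltr0_norm lx).
have -> : (p + 2)^-1 * - ln x = - (p + 2)^-1 * ln x by ring.
have -> : expR (- (p + 2)^-1 * ln x) = x `^ (- (p + 2)^-1) by rewrite /powR gt_eqF.
move=> h; apply: (@le_trans _ _ (x * (C * x `^ (- (p + 2)^-1)))).
  by rewrite ler_wpM2l// ltW.
have -> : x * (C * x `^ (- (p + 2)^-1)) = C * x `^ (p + 2)^-1 * x `^ (p / (p + 2)).
  rewrite mulrCA -mulrA; congr (_ * _).
  rewrite -{1}(powRr1 (ltW x0)) -!powRD ?(gt_eqF x0) ?implybT//; congr (_ `^ _).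
  by field; rewrite gt_eqF.
rewrite ler_wpM2r ?powR_ge0// mulrC -ler_pdivlMr//.
near: x.
have := powR_cvg0 v0 => /cvgr_le; apply.
by rewrite divr_gt0.
Unshelve. all: by end_near. Qed.

Theorem theorem8 (R : realType) (N : nat) (alpha beta l rho : R)
  (Omega : set 'rV[R]_N) (mL : ('rV[R]_N -> R) -> 'rV[R]_N -> R)
  (lam : nat -> R) (phi : nat -> 'rV[R]_N -> R) (r p : R)
  (hN : (1 <= N)%N) (halpha : 0 < alpha <= 1) (hbeta : 0 <= beta) (hl : 0 < l)
  (hrho : 1 < rho) (hOmega : smooth_bounded_domain Omega)
  (hL : symmetric_uniformly_elliptic Omega mL)
  (hlam : eigensystem Omega mL lam phi) (hr : 0 < r) (hp : 0 < p) :
  [/\ exists2 C : R, 0 < C &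
        forall (E delta tau : R) (g h hd gt Kgt : 'rV[R]_N -> R),
          0 < E -> exp_dom Omega lam phi r g ->
          exp_norm Omega lam phi r g <= E ->
          is_K alpha beta l Omega lam phi g h ->
          L2 Omega hd -> 0 < delta ->
          L2_norm Omega (hd \- h) <= delta ->
          0 < rho * delta < L2_norm Omega hd ->
          0 < tau -> is_regularized alpha beta l Omega lam phi r tau hd gt ->
          is_K alpha beta l Omega lam phi gt Kgt ->
          L2_norm Omega (Kgt \- hd) = rho * delta ->
          L2_norm Omega (gt \- g) <=
            C * delta * (1 + `|ln delta|) `^ r^-1 +
            C * E `^ (2 / (p + 2)) * (1 + rho) `^ (p / (p + 2)) *
              delta `^ (p / (p + 2)),
      (fun delta : R => delta * (1 + `|ln delta|) `^ r^-1 : R^o)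
        =o_ ((0 : R)^'+) (fun delta : R => delta `^ (p / (p + 2)) : R^o) &
      exists2 C : R, 0 < C &
        forall (E delta tau : R) (g h hd gt Kgt : 'rV[R]_N -> R),
          0 < E -> exp_dom Omega lam phi r g ->
          exp_norm Omega lam phi r g <= E ->
          is_K alpha beta l Omega lam phi g h ->
          L2 Omega hd -> 0 < delta ->
          L2_norm Omega (hd \- h) <= delta ->
          0 < rho * delta < L2_norm Omega hd ->
          0 < tau -> is_regularized alpha beta l Omega lam phi r tau hd gt ->
          is_K alpha beta l Omega lam phi gt Kgt ->
          L2_norm Omega (Kgt \- hd) = rho * delta ->
          L2_norm Omega (gt \- g) <=
            C * (1 + E) * (1 + rho) `^ (p / (p + 2)) * delta `^ (p / (p + 2))].
Proof.
have [oO _ _ _ _] := hOmega.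
have [ophi _ lam0 lam_homo _] := hlam.
have [C C0 hC] := regularized_L2_norm_le halpha hbeta hl hrho oO ophi lam0 lam_homo hr hp.
split.
- exists C => // E delta tau g h hd gt Kgt E0 Dg gE Kg Lhd d0 hdh _ tau0 Rgt Kgt_ KgtE.
  apply: le_trans (hC _ _ _ _ _ _ _ _ E0 Dg gE Kg Lhd d0 hdh tau0 Rgt Kgt_ KgtE) _.
  (* The second summand alone majorizes the error; the logarithmic one is nonnegative. *)
  rewrite -[leLHS]add0r; apply: lerD.
    by rewrite mulr_ge0 ?powR_ge0// mulr_ge0// ltW.
  by rewrite le_eqVlt; apply/orP; left; apply/eqP; ring.
- exact: littleo_mul_powR_ln.
- exists C => // E delta tau g h hd gt Kgt E0 Dg gE Kg Lhd d0 hdh _ tau0 Rgt Kgt_ KgtE.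
  apply: le_trans (hC _ _ _ _ _ _ _ _ E0 Dg gE Kg Lhd d0 hdh tau0 Rgt Kgt_ KgtE) _.
  rewrite -!mulrA ler_wpM2l ?(ltW C0)// mulrCA ler_wpM2r ?mulr_ge0 ?powR_ge0//.
  (* As the exponent 2 / (p + 2) lies between 0 and 1, the power of [E] is at most 1 if [E <= 1] and
     at most [E] otherwise. *)
  have [E1|/ltW E1] := leP E 1.
    apply: (@le_trans _ _ 1); last by rewrite lerDl ltW.
    rewrite -[leRHS](powRr0 E); apply: ger_powR; first by rewrite E0.
    by rewrite divr_ge0//; lra.
  apply: (@le_trans _ _ E); last by rewrite lerDr.
  by apply: ler1_powR => //; rewrite ler_pdivrMr ?mul1r; lra.
Qed.
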